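(* Let $d\geq 1$ be an integer. (a) Let $r\geq 4$ be an integer such that $r+1$ is prime and let $X$ be a set of $n\geq r(d+1)$ affinely spanning points in $\mathbb{R}^{n-d-1}$. If $X=X_1\sqcup\cdots\sqcup X_{d+1}$ is a $(d+1)$-coloring with $|X_i|\geq r$ for all $1\le i\le d+1$, then there exists a conical $r$-fan in $\mathbb{R}^{n-d-1}$ which rainbow distributes the $(d+1)$-coloring. (b) Let $r\geq 2$ be an integer such that $r+1$ is prime and let $X$ be a set of $n\geq r(2d+1)$ complex affinely spanning points in $\mathbb{C}^{n-d-1}$. If $X=X_1\sqcup\cdots\sqcup X_{2d+1}$ is a $(2d+1)$-coloring of $X$ such that $|X_i|\geq r$ for all $1\le i\le 2d+1$, then there exists a complex regular $r$-fan in $\mathbb{C}^{n-d-1}$ which rainbow distributes the $(2d+1)$-coloring.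
   Context: A set of points in $\mathbb{R}^D$ (resp. $\mathbb{C}^D$) is affinely spanning (resp. complex affinely spanning) if it is not contained in a real (resp. complex) affine hyperplane. An $m$-coloring of a finite set $X$ is a partition $X=X_1\sqcup\cdots\sqcup X_m$ into $m$ non-empty subsets (color classes). Fans. A $k$-flat is a $k$-dimensional affine subspace of $\mathbb{R}^D$ ($1\le k\le D-1$). If $A$ is a $k$-flat and $H$ is an affine hyperplane which intersects but does not contain $A$, then $B=A\cap H^+$, with $H^+$ a closed half-space of $H$, is a (closed) half $k$-flat; its boundary is $\partial B=A\cap H$. An $r$-fan is a union $F_r=\bigcup_{j=1}^r B_j$ of $r$ half $k$-flats which all have the same boundary $C$, a $(k-1)$-flat called the center. Write $\mathrm{Int}(B_j)=B_j\setminus C$ (the open half-flats). Rainbow distribution. An $r$-fan rainbow distributes a coloring $X=X_1\sqcup\cdots\sqcup X_m$ if $X\subseteq F_r$ and $|\mathrm{Int}(B_j)\cap X_i|\le 1$ for all $1\le j\le r$ and all $1\le i\le m$. Conical fans. Let $H_1,\ldots,H_r$ be oriented affine hyperplanes in $\mathbb{R}^D$ (each with a designated closed half-space $H_j^+$) such that (1) the normal vectors of any $r-1$ of them are linearly independent, and (2) the normal vectors of all $r$ of them are linearly dependent and $\bigcap_{i=1}^r H_i\neq\emptyset$. With indices taken cyclically mod $r$, let $A_j=\bigcap_{i\neq j-1,j}H_i$ and $B_j=H_j^+\cap A_j$. Then $F_r=\bigcup_{j=1}^r B_j$ is an $r$-fan of codimension $r-2$ with center $\bigcap_{i=1}^r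 H_i$; such an $r$-fan is called conical. Complex regular fans. A regular $r$-fan is an $r$-fan of codimension one for which the dihedral angle between any two successive half-hyperplanes is $2\pi/r$. A complex regular $r$-fan in $\mathbb{C}^D\cong\mathbb{R}^{2D}$ is a regular $r$-fan in $\mathbb{R}^{2D}$ whose center is a complex affine hyperplane. Equivalently, with $\langle u,w\rangle=\sum_i u_i\overline{w_i}$ and $\omega_r=\exp(2\pi \mathrm{i}/r)$, there are $\alpha\in\mathbb{C}^D\setminus\{0\}$, $\beta\in\mathbb{C}$ with $B_j=\{z\in\mathbb{C}^D\mid \langle\alpha,z\rangle=\beta+t\omega_r^j\text{ for some real }t\geq 0\}$ for $j=1,\ldots,r$. *)

(* Defs.v *)
From HB Require Import structures.
From mathcomp Require Import all_boot all_order all_algebra finmap.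
From mathcomp Require Import complex.
From mathcomp Require Import all_classical all_reals all_analysis.
Set Implicit Arguments.
Unset Strict Implicit.
Unset Printing Implicit Defensive.
Import Order.TTheory GRing.Theory Num.Theory.
Local Open Scope classical_set_scope.
Local Open Scope card_scope.
Local Open Scope ring_scope.

(* The bilinear dot product.  Over R[i] it is not Hermitian, but the sets
   [set x | dotv a x = b] with a != 0 are all the complex affine hyperplanes. *)
Definition dotv (F : fieldType) m (a x : 'rV[F]_m) : F :=
  \sum_i a 0 i * x 0 i.

Definition hyperplane (F : fieldType) m (a : 'rV[F]_m) (b : F) :
    set 'rV[F]_m :=
  [set x | dotv a x = b].

(* The opposite closed half-space is halfspace (- a) (- b): an oriented
   hyperplane is a pair (a, b) with a != 0. *)
Definition halfspace (R : realType) m (a : 'rV[R]_m) (b : R) :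
    set 'rV[R]_m :=
  [set x | b <= dotv a x].

Definition is_hyperplane (F : fieldType) m (H : set 'rV[F]_m) :=
  exists (a : 'rV[F]_m) (b : F), a != 0 /\ H = hyperplane a b.

Definition affinely_spanning (F : fieldType) m (X : set 'rV[F]_m) :=
  forall H : set 'rV[F]_m, is_hyperplane H -> ~ (X `<=` H).

Definition coloring (T : choiceType) m (Xs : 'I_m -> {fset T}) (X : {fset T}) :=
  partition [set: 'I_m] (fun i => [set` Xs i]) [set` X].

Definition is_flat (F : fieldType) m k (A : set 'rV[F]_m) :=
  exists (p : 'rV[F]_m) (V : 'M[F]_m),
    \rank V = k /\ A = [set x | (x - p <= V)%MS].

Definition half_flat (R : realType) m k (B C : set 'rV[R]_m) :=
  exists (A : set 'rV[R]_m) (a : 'rV[R]_m) (b : R),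
    [/\ (0 < k < m)%N, is_flat k A & a != 0] /\
    [/\ A `&` hyperplane a b !=set0, ~ (A `<=` hyperplane a b),
        B = A `&` halfspace a b & C = A `&` hyperplane a b].

(* An r-fan of dimension k, given by its r distinct half-flats B j and its
   center C; the fan as a set of points is \bigcup_j B j. *)
Definition fan (R : realType) m r k (B : 'I_r -> set 'rV[R]_m)
    (C : set 'rV[R]_m) :=
  injective B /\ forall j, half_flat k (B j) C.

Definition rainbow_distributes (T : choiceType) r m
    (B : 'I_r -> set T) (C : set T) (Xs : 'I_m -> {fset T}) (X : {fset T}) :=
  [set` X] `<=` \bigcup_j B j /\
  forall j i, ((B j `\` C) `&` [set` Xs i]) #<= `I_1.

(* Row j of N is the normal vector of H_j = hyperplane (row j N) (b j), and
   its designated half-space is halfspace (row j N) (b j). *)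
Definition conical_fan (R : realType) m r (B : 'I_r -> set 'rV[R]_m)
    (C : set 'rV[R]_m) :=
  exists (N : 'M[R]_(r, m)) (b : 'I_r -> R),
    let H j := hyperplane (row j N) (b j) in
    [/\ forall j, row_free (row' j N),
        ~~ row_free N /\ \bigcap_j H j !=set0,
        C = \bigcap_j H j &
        forall j, B j = halfspace (row j N) (b j) `&`
                        \bigcap_(i in [set i | i != ord_pred j /\ i != j]) H i].

(* u is the unit vector orthogonal to C and pointing into the half-flat B,
   where dim B = dim C + 1. *)
Definition inner_normal (R : realType) m (C B : set 'rV[R]_m) (u : 'rV[R]_m) :=
  [/\ dotv u u = 1,
      forall x y, C x -> C y -> dotv u (x - y) = 0 &
      B = [set z | exists c t, [/\ C c, 0 <= t & z = c + t *: u]]].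

(* The angle, in `[0, pi], between half-hyperplanes B1, B2 with boundary C. *)
Definition dihedral_angle (R : realType) m (C B1 B2 : set 'rV[R]_m)
    (theta : R) :=
  exists u1 u2, [/\ inner_normal C B1 u1, inner_normal C B2 u2 &
                    theta = acos (dotv u1 u2)].

(* The half-hyperplanes are listed in cyclic order around the center: being
   distinct, with consecutive ones at angle 2 pi / r, they cannot backtrack. *)
Definition regular_fan (R : realType) m r (B : 'I_r -> set 'rV[R]_m)
    (C : set 'rV[R]_m) :=
  fan m.-1 B C /\
  forall j, dihedral_angle C (B j) (B (ordS j)) (2 * pi / r%:R).

Definition realify (R : realType) D (z : 'rV[R[i]]_D) : 'rV[R]_(D + D) :=
  row_mx (map_mx (@complex.Re R) z) (map_mx (@complex.Im R) z).

Definition complex_regular_fan (R : realType) D r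
    (B : 'I_r -> set 'rV[R[i]]_D) (C : set 'rV[R[i]]_D) :=
  regular_fan (fun j => @realify R D @` B j) (@realify R D @` C) /\
  is_hyperplane C.

(* Main.v *)
(* By Gale duality the affine functions on the n points correspond to the
   vectors f with \sum_x f x *: G x = 0, where the G x are n vectors of an
   e-dimensional real space (e = d in (a), e = 2d in (b)).  The colourful
   Tverberg theorem of Blagojevic, Matschke and Ziegler for the prime r + 1,
   applied to the G x and to one auxiliary point whose class is then dropped,
   gives r disjoint rainbow classes with weights T whose weighted sums of G x
   agree.  Writing T_j for the restriction of T to class j, the functions
   T_j - T_(j+1) cut out a conical fan, and \sum_j w^j T_j with
   w = exp (2 pi i / r) cuts out a complex regular fan.

   The Tverberg theorem is proved by a degree computed modulo the prime
   p = r + 1.  A choice of classes is a tuple of permutations of p classes; the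
   signed number of choices whose cone contains a generic vector u is, modulo
   p, insensitive to the replacement of a point by another one, because the
   error terms come in orbits of size p under the cyclic shift of the classes.
   For points placed at the vertices of a simplex it is a power of (p - 1)!,
   which is not divisible by p.  The non-generic case follows by compactness. *)
Require Import Defs.
From mathcomp Require Import all_boot all_order all_algebra finmap.
From mathcomp Require Import complex fingroup perm.
From mathcomp Require Import all_classical all_reals all_analysis.
From mathcomp Require Import zify ring lra.
Set Implicit Arguments.
Unset Strict Implicit.
Unset Printing Implicit Defensive.
Import Order.TTheory GRing.Theory Num.Theory.
Import numFieldNormedType.Exports.
Local Open Scope classical_set_scope.
Local Open Scope ring_scope.

(** * Signed cones *)

Section ConeIndicator.
Variable R : realFieldType.

(* The set of x with [a l * x <= a l * rho l] for all l is an interval: the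
   bounds rho k that are attained are its endpoints, a lower and an upper one
   cancel, and the sum detects whether the interval is unbounded above. *)
Lemma sum_endpoints (J : finType) (a rho : J -> R) :
  (forall k, a k != 0) -> injective rho -> (exists k, a k < 0) ->
  \sum_k sgz (a k) * [forall l, a l * rho k <= a l * rho l]%:R =
  - [forall k, a k < 0]%:R.
Proof.
move=> a0 rho_inj [k0 ak0].
pose F k := [forall l, a l * rho k <= a l * rho l].
have FP k : reflect (forall l, if 0 < a l then rho k <= rho l else rho l <= rho k) (F k).
  apply: (iffP forallP) => h l; have := h l;
    (case: ltP => al; first by rewrite ler_pM2l);
    by rewrite ler_nM2l // lt_neqAle a0.
have nge k : ~~ (0 < a k) = (a k < 0) by rewrite -leNgt lt_neqAle a0.
(* A negative [a l] makes [rho l] a lower bound; [rho m] is the largest of these. *)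
pose m := [arg max_(i > k0 | a i < 0) rho i]%O.
have [am mP] : a m < 0 /\ forall l, a l < 0 -> rho l <= rho m.
  by rewrite /m; case: arg_maxP.
case: (pickP (fun k => 0 < a k)) => [k1 ak1|npos]; last first.
  have alln k : a k < 0 by rewrite -nge npos.
  have -> : [forall k, a k < 0] by apply/forallP.
  rewrite (bigD1 m) //= big1 ?addr0 => [|k km]; last first.
    rewrite -/(F k); case: FP => [/(_ m)|_]; last by rewrite mulr0.
    rewrite npos => mk; case/negP: km; apply/eqP/rho_inj/le_anti.
    by rewrite mk mP.
  rewrite -/(F m); have -> : F m by apply/FP => l; rewrite npos mP.
  by rewrite mulr1 ltr0_sgz.
(* [rho M] is the smallest upper bound. No other bound can be attained, and these two are attained
   under the same condition [rho m <= rho M]. *)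
pose M := [arg min_(i < k1 | 0 < a i) rho i]%O.
have [aM MP] : 0 < a M /\ forall l, 0 < a l -> rho M <= rho l.
  by rewrite /M; case: arg_minP.
have -> : [forall k, a k < 0] = false.
  by apply/forallP => /(_ M); rewrite ltNge (ltW aM).
have mM : M != m by apply: contraTneq aM => ->; rewrite -leNgt ltW.
rewrite (bigD1 m) //= (bigD1 M) //= big1 ?addr0 => [|k /andP[km kM]]; last first.
  rewrite -/(F k); case: FP => [h|_]; last by rewrite mulr0.
  case: (boolP (0 < a k)) => ak.
    case/negP: kM; apply/eqP/rho_inj/le_anti; rewrite MP // andbT.
    by have := h M; rewrite aM.
  case/negP: km; apply/eqP/rho_inj/le_anti; rewrite mP /= -?nge //.
  by have := h m; rewrite ltNge (ltW am).
rewrite -/(F m) -/(F M) ltr0_sgz // gtr0_sgz // mulN1r mul1r.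
suff -> : F m = F M by rewrite addNr oppr0.
have nam : (0 < a m) = false by rewrite ltNge (ltW am).
apply/FP/FP => h l.
  have hM := h M; rewrite aM in hM.
  case: (boolP (0 < a l)) => al; first exact: MP.
  by apply: le_trans hM; apply: mP; rewrite -nge.
have hm := h m; rewrite nam in hm.
case: (boolP (0 < a l)) => al; last by apply: mP; rewrite -nge.
by apply: le_trans hm _; apply: MP.
Qed.

(* Local degree at [u] of the linear parametrization of the cone on the rows
   of [M]; it is [0] when [M] is singular. *)
Definition cone_sign n (M : 'M[R]_n) (u : 'rV_n) : int :=
  sgz (\det M) * [forall k, 0 <= (u *m invmx M) 0 k]%:R.

Definition set_row n (M : 'M[R]_n) (k : 'I_n) (a : 'rV_n) : 'M[R]_n :=
  \matrix_(i, j) (if i == k then a 0 j else M i j).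

Lemma row_set_row n (M : 'M[R]_n) k a i :
  row i (set_row M k a) = if i == k then a else row i M.
Proof. by apply/rowP => j; rewrite !mxE; case: eqP => //= _; rewrite mxE. Qed.

Lemma mul_set_row n (M : 'M[R]_n) k a (t : 'rV_n) :
  t *m set_row M k a = t *m M + t 0 k *: (a - row k M).
Proof.
rewrite !mulmx_sum_row (bigD1 k) //= [in RHS](bigD1 k) //=.
rewrite row_set_row eqxx scalerBr [RHS]addrC addrA subrK.
by congr (_ + _); apply: eq_bigr => i /negPf ik; rewrite row_set_row ik.
Qed.

(** Cramer's rule: the cofactors along row [k] do not see the new row, so the expansion is an entry
    of [b *m M *m \adj M]. *)
Lemma det_set_row n (M : 'M[R]_n) k (b : 'rV_n) :
  \det (set_row M k (b *m M)) = b 0 k * \det M.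
Proof.
rewrite (expand_det_row _ k).
transitivity ((b *m M *m \adj M) 0 k).
  rewrite mxE; apply: eq_bigr => j _; rewrite !mxE eqxx; congr (_ * _).
  rewrite /cofactor; congr (_ * \det _); apply/matrixP => i l.
  by rewrite !mxE eq_sym (negPf (neq_lift _ _)).
by rewrite -mulmxA mul_mx_adj mul_mx_scalar mxE mulrC.
Qed.

(* The homological boundary of the simplex on the rows of M and [al *m M],
   seen from u: it does not depend on u. *)
Lemma cone_sign_exchange n (M : 'M[R]_n) (al t : 'rV_n) :
    M \in unitmx -> (forall k, al 0 k != 0) -> (forall k, t 0 k != 0) ->
    (forall k l, k != l -> t 0 k * al 0 l != t 0 l * al 0 k) ->
  cone_sign M (t *m M) - \sum_k cone_sign (set_row M k (al *m M)) (t *m M) =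
  sgz (\det M) * [forall k, al 0 k < 0]%:R.
Proof.
move=> uM al0 t0 tal.
(* The interval consists of the [x >= 0] for which [t - x *: al] is nonnegative: [None] is the
   constraint [0 <= x], and [Some k] is [al 0 k * x <= t 0 k]. The endpoint of [None] corresponds to
   the cone on [M], that of [Some k] to the cone with row [k] replaced. *)
pose A (o : option 'I_n) := if o is Some k then al 0 k else -1.
pose rho (o : option 'I_n) := if o is Some k then t 0 k / al 0 k else 0.
have A0 o : A o != 0 by case: o => [k|] //=; rewrite oppr_eq0 oner_eq0.
have rho_inj : injective rho.
  have tne k : t 0 k / al 0 k != 0 by rewrite mulf_neq0 ?invr_eq0.
  move=> [k|] [l|] //= h; last 2 first.
  - by case/eqP: (tne k).
  - by case/eqP: (tne l).
  case: (eqVneq k l) => [->//|/tal/negP[]].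
  by move/eqP: h; rewrite eqr_div.
have := sum_endpoints A0 rho_inj (ex_intro _ None (ltrN10 _)).
rewrite (bigD1 None) //= (reindex_omap Some id) /=; last by case.
under eq_bigl => k do rewrite eqxx.
rewrite sgzN sgz1 mulN1r => h.
have K l : al 0 l * (t 0 l / al 0 l) = t 0 l by rewrite mulrC divfK.
have E k : cone_sign (set_row M k (al *m M)) (t *m M) = sgz (\det M) *
   (sgz (al 0 k) * [forall l, A l * (t 0 k / al 0 k) <= A l * rho l]%:R).
  rewrite /cone_sign det_set_row sgzM -mulrA mulrCA; congr (_ * (_ * _)).
  have uMk : set_row M k (al *m M) \in unitmx.
    by rewrite unitmxE det_set_row unitfE mulf_neq0 ?al0 // -unitfE -unitmxE.
  pose x := t 0 k / al 0 k.
  have -> : t *m M *m invmx (set_row M k (al *m M)) =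
     \row_l (if l == k then x else t 0 l - al 0 l * x).
    apply: (canLR (mulmxK uMk)).
    rewrite mul_set_row !mxE eqxx.
    suff -> : \row_l (if l == k then x else t 0 l - al 0 l * x) =
       t - x *: (al - delta_mx 0 k).
      by rewrite mulmxBl -scalemxAl mulmxBl rowE subrK.
    apply/rowP => l; rewrite !mxE eqxx /=; case: eqP => [->|_]; last first.
      by rewrite subr0 mulrC.
    by rewrite /x mulrBr divfK // mulr1 opprB addrC subrK.
  congr (nat_of_bool _)%:R; apply/forallP/forallP => h1 l.
    case: l => [l|] /=.
      have := h1 l; rewrite mxE; case: eqP => [->//|_].
      by rewrite subr_ge0 K.
    by have := h1 k; rewrite mxE eqxx mulr0 mulN1r oppr_le0.
  rewrite mxE; case: eqP => _.
    by have := h1 None; rewrite /= mulr0 mulN1r oppr_le0.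
  by have := h1 (Some l); rewrite /= subr_ge0 K.
under eq_bigr => k _ do rewrite E.
rewrite /cone_sign mulmxK // -mulr_sumr -mulrBr; congr (_ * _).
have -> : [forall k, al 0 k < 0] = [forall k, A k < 0].
  apply/forallP/forallP => h1 k; last exact: (h1 (Some k)).
  by case: k => [k|] //=; exact: ltrN10.
apply: oppr_inj; rewrite -h opprB [LHS]addrC. congr (_ + _).
congr (- (_ *+ nat_of_bool _)); apply/forallP/forallP => h1 l.
  case: l => [l|] /=; last by rewrite mulr0.
  by rewrite mulr0 K.
by have := h1 (Some l); rewrite /= mulr0 K.
Qed.

End ConeIndicator.

(** * The degree modulo the number of classes *)

Section ColouredDegree.
Variables (R : realFieldType) (k r N : nat).
Variables (col : 'I_N -> 'I_k.+1) (pos : 'I_N -> 'I_r.+1).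
Hypothesis pos_max : forall q, pos q != ord_max.
Hypothesis col_pos_inj : forall q q', col q = col q' -> pos q = pos q' -> q = q'.

Notation colouring := {ffun 'I_k.+1 -> 'S_r.+1}.

(* In each colour, the [r] points are placed injectively into [r.+1] classes;
   the permutation sends [ord_max] to the class which is left out. *)
Definition class_of (P : colouring) q := P (col q) (pos q).

Definition colouring_sign (P : colouring) : int := \prod_i (-1) ^+ (P i).

(** Moves [q] into the class that its colour leaves out; the former class of [q] is left out
    instead. *)
Definition swap_out q (P : colouring) : colouring :=
  [ffun i => if i == col q then (tperm (pos q) ord_max * P i)%g else P i].

Definition cyclic_perm : 'S_r.+1 := perm (@ordS_inj r.+1).

Definition shift (P : colouring) : colouring := [ffun i => (P i * cyclic_perm)%g].

Lemma swap_outK q : involutive (swap_out q).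
Proof.
move=> P; apply/ffunP => i; rewrite !ffunE; case: eqP => // _.
by rewrite mulgA tperm2 mul1g.
Qed.

Lemma colouring_sign_swap q P : colouring_sign (swap_out q P) = - colouring_sign P.
Proof.
rewrite /colouring_sign (bigD1 (col q)) //= [in RHS](bigD1 (col q)) //=.
rewrite ffunE eqxx odd_mul_tperm pos_max /= -mulNr; congr (_ * _).
  by rewrite signrN.
by apply: eq_bigr => i /negPf qi; rewrite ffunE qi.
Qed.

Lemma class_of_swap q q' P : q' != q -> class_of (swap_out q P) q' = class_of P q'.
Proof.
move=> qq'; rewrite /class_of ffunE; case: (eqVneq (col q') (col q)) => // e.
rewrite permM tpermD // eq_sym; last exact: pos_max.
by apply: contra qq' => /eqP h; apply/eqP/col_pos_inj.
Qed.

Lemma class_of_swap_out q P : class_of (swap_out q P) q = P (col q) ord_max.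
Proof. by rewrite /class_of ffunE eqxx permM tpermL. Qed.

Lemma class_of_shift P q : class_of (shift P) q = ordS (class_of P q).
Proof. by rewrite /class_of ffunE permM permE. Qed.

Lemma cyclic_perm_expE m j : val ((cyclic_perm ^+ m)%g j) = ((j + m) %% r.+1)%N.
Proof.
elim: m => [|m IH]; first by rewrite expg0 perm1 addn0 modn_small.
by rewrite expgSr permM permE /= IH -addn1 modnDml -addnA addn1.
Qed.

Lemma cyclic_perm_exp : (cyclic_perm ^+ r.+1)%g = 1%g.
Proof.
by apply/permP => j; apply: val_inj; rewrite cyclic_perm_expE modnDr perm1 modn_small.
Qed.

Lemma shift_inj : injective shift.
Proof.
move=> P Q /ffunP h; apply/ffunP => i; have := h i.
by rewrite !ffunE => /mulIg.
Qed.

Hypothesis odd_classes : odd r.+1.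

(** The order of the cycle divides the odd number [r.+1]. *)
Lemma cyclic_perm_even : odd_perm cyclic_perm = false.
Proof.
have := congr1 (@odd_perm _) cyclic_perm_exp; rewrite odd_perm1.
have H m : odd_perm (cyclic_perm ^+ m)%g = odd m && odd_perm cyclic_perm.
  elim: m => [|m IH]; first by rewrite expg0 odd_perm1.
  by rewrite expgS odd_permM IH /=; case: odd; case: odd_perm.
by rewrite H odd_classes.
Qed.

Lemma colouring_sign_shift P : colouring_sign (shift P) = colouring_sign P.
Proof.
by apply: eq_bigr => i _; rewrite ffunE odd_permM cyclic_perm_even addbF.
Qed.

(** The colourings split into [r.+1] blocks by the value of [P ord0 ord0]; [shift] permutes the
    blocks cyclically, so their sums are equal. *)
Lemma dvd_sum_shift (F : colouring -> int) :
  (forall P, F (shift P) = F P) -> (r.+1 %| \sum_P F P)%Z.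
Proof.
move=> Fshift; pose A j := \sum_(P : colouring | P ord0 ord0 == j) F P.
have -> : \sum_P F P = \sum_j A j.
  by rewrite (partition_big (fun P : colouring => P ord0 ord0) predT).
have AS j : A (ordS j) = A j.
  rewrite /A (reindex_inj shift_inj) /=.
  apply: eq_big => [P|P _]; last exact: Fshift.
  by rewrite ffunE permM permE (inj_eq (@ordS_inj _)).
have AE m : A (inord m) = A ord0.
  elim: m => [|m IH]; first by congr A; apply: val_inj; rewrite /= inordK.
  case: (ltnP m.+1 r.+1) => mr.
    by rewrite -IH -[RHS]AS; congr A; apply: val_inj; rewrite /= (inordK mr) (inordK (ltnW mr)) modn_small.
  (* Out of range, [inord] falls back to [ord0]. *)
  by congr A; apply: val_inj; rewrite /= /inord /insubd insubN //= -leqNgt.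
rewrite (eq_bigr (fun _ => A ord0)) => [|j _]; last by rewrite -[j]inord_val AE.
by rewrite sumr_const card_ord -mulr_natl dvdz_mulr // natz.
Qed.

(** A sign-reversing involution. *)
Lemma sum_swap_eq0 q (H : colouring -> int) :
  (forall P, H (swap_out q P) = H P) -> \sum_P colouring_sign P * H P = 0.
Proof.
move=> Hs; set S := \sum_P _.
have : S = - S.
  rewrite {1}/S (reindex_inj (inv_inj (swap_outK q))) /= -sumrN.
  by apply: eq_bigr => P _; rewrite colouring_sign_swap Hs mulNr.
by move=> /eqP; rewrite -subr_eq0 opprK -mulr2n mulrn_eq0 => /eqP.
Qed.

Variables (G : 'I_r.+1 -> 'M[R]_N) (g : 'M[R]_N).
Hypothesis G_ordS : forall j, G (ordS j) = G j *m g.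
Hypothesis det_g : 0 < \det g.

Definition class_mx (v : 'I_N -> 'rV[R]_N) (P : colouring) : 'M[R]_N :=
  \matrix_q (v q *m G (class_of P q)).

Definition degree v u : int :=
  \sum_P colouring_sign P * cone_sign (class_mx v P) u.

Lemma class_mx_shift v P : class_mx v (shift P) = class_mx v P *m g.
Proof.
apply/row_matrixP => q; rewrite row_mul !rowK class_of_shift G_ordS mulmxA.
by [].
Qed.

(* The terms of the exchange formula in which a point other than s is removed
   cancel in pairs under [swap_out]; what remains is invariant under [shift]. *)
Lemma degree_move (v v' : 'I_N -> 'rV[R]_N) (s : 'I_N) (u : 'rV[R]_N) :
    (forall q, q != s -> v' q = v q) ->
    (forall P, exists al t : 'rV_N,
      [/\ class_mx v P \in unitmx,
          v' s *m G (class_of P s) = al *m class_mx v P, u = t *m class_mx v P,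
          (forall q, al 0 q != 0) /\ (forall q, t 0 q != 0) &
          forall q q', q != q' -> t 0 q * al 0 q' != t 0 q' * al 0 q]) ->
  (r.+1 %| degree v u - degree v' u)%Z.
Proof.
move=> vv' gen; pose a P := v' s *m G (class_of P s).
(* The right-hand side of the exchange formula. It does not involve [u], and [shift] preserves it
   because all vectors are multiplied by the same [g] of positive determinant. *)
pose E P := sgz (\det (class_mx v P)) *
  [forall q, (a P *m invmx (class_mx v P)) 0 q < 0]%:R.
have exch P : cone_sign (class_mx v P) u -
    \sum_q cone_sign (set_row (class_mx v P) q (a P)) u = E P.
  have [al [t [uM aE -> [al0 t0] tal]]] := gen P.
  rewrite /E /a aE; under [in RHS]eq_forallb => q do rewrite mulmxK //.
  exact: cone_sign_exchange.
have ES P : E (shift P) = E P.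
  have [al [t [uM aE _ _ _]]] := gen P.
  have uMg : class_mx v (shift P) \in unitmx.
    by rewrite class_mx_shift unitmx_mul uM unitmxE unitfE gt_eqF.
  have aS : a (shift P) = al *m class_mx v (shift P).
    by rewrite class_mx_shift /a class_of_shift G_ordS !mulmxA -aE.
  rewrite /E aS {1}class_mx_shift det_mulmx sgzM (gtr0_sgz det_g) mulr1.
  by congr (_ * (nat_of_bool _)%:R); apply: eq_forallb => q; rewrite /a aE !mulmxK.
suff -> : degree v u - degree v' u = \sum_P colouring_sign P * E P.
  by apply: dvd_sum_shift => P; rewrite ES colouring_sign_shift.
under [in RHS]eq_bigr => P _ do rewrite -exch mulrBr (bigD1 s) //= mulrDr opprD addrA mulr_sumr.
rewrite !big_split /= !sumrN exchange_big /= [X in _ = _ - X]big1 ?subr0 => [|q qs].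
  congr (_ - _); apply: eq_bigr => P _; congr (_ * cone_sign _ _).
  apply/row_matrixP => q; rewrite row_set_row !rowK.
  by case: eqVneq => [->//|/vv' ->].
apply: (sum_swap_eq0 (q := q)) => P; congr cone_sign; apply/row_matrixP => q'.
rewrite !row_set_row !rowK /a class_of_swap; last by rewrite eq_sym.
by case: eqVneq => // /class_of_swap ->.
Qed.

End ColouredDegree.

(** * General position *)

Section Genericity.
Variables (R : realFieldType) (N : nat).

(* x lies on no proper subspace spanned by members of L; a spanning family of
   fewer than N vectors is encoded as an N x N matrix with a zero row. *)
Definition generic_to (L : seq 'rV[R]_N) (x : 'rV[R]_N) : Prop :=
  forall Q : 'M[R]_N, (forall i, row i Q \in L) -> (exists i, row i Q = 0) ->
    ~~ (x <= Q)%MS.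

Lemma generic_coord_neq0 (L : seq 'rV[R]_N) (u t : 'rV[R]_N) (M : 'M[R]_N) :
    generic_to L u -> 0 \in L -> (forall i, row i M \in L) -> u = t *m M ->
  forall q, t 0 q != 0.
Proof.
move=> ug L0 LM uE q; apply/eqP => tq.
have LQ i : row i (set_row M q 0) \in L by rewrite row_set_row; case: eqP.
have Q0 : exists i, row i (set_row M q 0) = 0 by exists q; rewrite row_set_row eqxx.
case/negP: (ug _ LQ Q0); rewrite uE (_ : t *m M = t *m set_row M q 0) ?submxMl //.
by rewrite mul_set_row tq scale0r addr0.
Qed.

(** There are [size p] candidates [d / i.+1%:R], more than [p] has roots. *)
Lemma exists_nonroot (p : {poly R}) (d : R) :
  p != 0 -> 0 < d -> exists2 x, 0 < x <= d & ~~ root p x.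
Proof.
move=> p0 d0; pose rs := [seq d / i.+1%:R | i <- iota 0 (size p)].
have rs_uniq : uniq rs.
  rewrite map_inj_uniq ?iota_uniq // => i j /(mulfI (lt0r_neq0 d0)) /invr_inj.
  by move/(mulrIn (oner_neq0 R)) => [].
case: (boolP (all (root p) rs)) => [h|/allPn[x /mapP[i _ ->] nx]].
  by have := max_poly_roots p0 h rs_uniq; rewrite size_map size_iota ltnn.
exists (d / i.+1%:R) => //; rewrite divr_gt0 ?ltr0Sn //=.
by rewrite ler_pdivrMr ?ltr0Sn // ler_peMr ?ler1n // ltW.
Qed.

Lemma root_prod (I : finType) (F : I -> {poly R}) i t :
  root (F i) t -> root (\prod_j F j) t.
Proof. by rewrite (bigD1 i) //= rootM => ->. Qed.

(* Perturb x along the moment curve, which meets every hyperplane finitely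
   often. *)
Lemma exists_generic (L : seq 'rV[R]_N) (x : 'rV[R]_N) (d : R) : 0 < d ->
  exists2 y : 'rV[R]_N, forall j, `|y 0 j - x 0 j| <= d & generic_to L y.
Proof.
move=> d0; pose Qf (f : {ffun 'I_N -> 'I_(size L)}) : 'M[R]_N := \matrix_i L`_(f i).
(* The columns [h f j] are equations of the row space of [Qf f], and [p f j] is such an equation
   along the curve with coordinates [x 0 i + t ^+ i.+1]. Trivial equations are replaced by [1] in
   [P]. *)
pose h f (j : 'I_N) : 'cV_N := col j (cokermx (Qf f)).
pose p f j : {poly R} := \sum_i (h f j i 0) *: 'X^(i.+1) + ((x *m h f j) 0 0)%:P.
have pE f j i : (p f j)`_i.+1 = if insub i is Some i' then h f j i' 0 else 0.
  rewrite coefD coefC /= addr0 coef_sum; case: insubP => [i' _ <-|].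
    rewrite (bigD1 i') //= coefZ coefXn eqxx mulr1 big1 ?addr0 // => l li.
    by rewrite coefZ coefXn eqSS eq_sym (inj_eq val_inj) (negPf li) mulr0.
  rewrite -leqNgt => Ni; rewrite big1 // => l _; rewrite coefZ coefXn eqSS.
  by rewrite gtn_eqF ?mulr0 // (leq_trans (ltn_ord l)).
pose P := \prod_f \prod_j (if h f j == 0 then 1 else p f j).
have P0 : P != 0.
  apply/prodf_neq0 => f _; apply/prodf_neq0 => j _.
  case: ifPn => [_|/negP hj]; first exact: oner_neq0.
  apply/negP => /eqP pj; apply: hj; apply/eqP/matrixP => i l.
  by rewrite (ord1 l) [RHS]mxE; have := pE f j i; rewrite pj coef0 valK.
(* With [t <= 1] every power of [t] on the curve is at most [t <= d]. *)
have d1 : 0 < Num.min d 1 by rewrite lt_min d0 ltr01.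
have [t /andP[t0]] := exists_nonroot P0 d1; rewrite le_min => /andP[td t1] Pt.
exists (x + \row_j t ^+ j.+1) => [j|Q QL [i0 Qi0]].
  rewrite !mxE addrAC subrr add0r ger0_norm; last by rewrite exprn_ge0 ?ltW.
  by apply: le_trans td; rewrite exprS ler_piMr ?exprn_ile1 // ltW.
have ltL i : (index (row i Q) L < size L)%N by rewrite index_mem.
pose f := [ffun i => Ordinal (ltL i)].
have QE : Qf f = Q.
  by apply/row_matrixP => i; rewrite rowK ffunE /= nth_index.
(* A matrix with a zero row is singular, so its row space has a nontrivial equation. *)
have [j hj] : exists j, h f j != 0.
  apply/existsP; apply: contraT; rewrite negb_exists => /forallP h0.
  have : cokermx Q = 0.
    by apply/matrixP => i j; have := h0 j; rewrite negbK /h QE => /eqP/colP/(_ i);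
    rewrite [LHS]mxE [RHS]mxE => ->; rewrite mxE.
  move/eqP; rewrite -mxrank_eq0 mxrank_coker subn_eq0 => rQ.
  have : row_free Q by rewrite -row_leq_rank.
  move/row_freeP => [Q' QQ']; have := congr1 (row i0) QQ'.
  rewrite row_mul Qi0 mul0mx row1 => /rowP/(_ i0); rewrite !mxE !eqxx.
  by move/esym/eqP; rewrite oner_eq0.
apply: contra Pt => yQ; suff pt : root (p f j) t.
  by apply: (root_prod (i := f)); apply: (root_prod (i := j)); rewrite (negPf hj).
apply/eqP.
have <- : ((x + \row_j t ^+ j.+1) *m h f j) 0 0 = 0.
  by move: yQ; rewrite submxE /h QE colE (mulmxA _ (cokermx Q)) => /eqP ->; rewrite mul0mx mxE.
rewrite /p hornerD hornerC horner_sum addrC mulmxDl [RHS]mxE; congr (_ + _).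
rewrite [RHS]mxE; apply: eq_bigr => i _.
by rewrite hornerZ hornerXn [X in _ = X * _]mxE mulrC.
Qed.

Variables (k r : nat) (col : 'I_N -> 'I_k.+1) (pos : 'I_N -> 'I_r.+1).
Variables (G : 'I_r.+1 -> 'M[R]_N) (e : 'I_N -> 'rV[R]_N).

(** The vectors whose spans a new point has to avoid. The bound [m] admits only earlier moving
    points, so that points can be made generic one after another; [0] serves to encode smaller
    families. *)
Definition translates (x : 'I_N -> 'rV[R]_N) (m : nat) : seq 'rV[R]_N :=
  0 :: [seq e q *m G j | q <- enum 'I_N, j <- enum 'I_r.+1] ++
       [seq x q *m G j | q <- [seq q : 'I_N <- enum 'I_N | (q < m)%N], j <- enum 'I_r.+1].

Lemma translates_fixed x m q j : e q *m G j \in translates x m.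
Proof.
rewrite inE mem_cat; apply/or3P; constructor 2; apply/allpairsP.
by exists (q, j); split; rewrite ?mem_enum.
Qed.

Lemma translates_moving x m (q : 'I_N) j : (q < m)%N -> x q *m G j \in translates x m.
Proof.
move=> qm; rewrite inE mem_cat; apply/or3P; constructor 3; apply/allpairsP.
by exists (q, j); split; rewrite //= ?mem_enum // mem_filter mem_enum qm.
Qed.

Lemma eq_translates x y m : (forall q : 'I_N, (q < m)%N -> x q = y q) ->
  translates x m = translates y m.
Proof.
move=> xy; congr (_ :: _ ++ _); apply/eq_in_allpairs => q j.
by rewrite mem_filter => /andP[/xy -> _].
Qed.

Definition generic_family x := forall q : 'I_N, generic_to (translates x q) (x q).

Lemma exists_generic_family (x : 'I_N -> 'rV[R]_N) (d : R) : 0 < d ->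
  exists2 y : 'I_N -> 'rV[R]_N, forall q j, `|y q 0 j - x q 0 j| <= d & generic_family y.
Proof.
move=> d0.
suff H m : (m <= N)%N -> exists2 y : 'I_N -> 'rV_N,
    forall q j, `|y q 0 j - x q 0 j| <= d &
    forall q : 'I_N, (q < m)%N -> generic_to (translates y q) (y q).
  by have [y yx yg] := H N (leqnn _); exists y => // q; apply: yg.
elim: m => [_|m IH mN].
  by exists x => // q j; rewrite subrr normr0 ltW.
have [y yx yg] := IH (ltnW mN).
have [z zx zg] := exists_generic (translates y m) (x (Ordinal mN)) d0.
exists (fun q => if q == Ordinal mN then z else y q) => q; first by case: eqP => [->|].
have E n : (n <= m)%N ->
   translates (fun q => if q == Ordinal mN then z else y q) n = translates y n.
  move=> nm; apply: eq_translates => q' q'n.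
  by case: eqP => // q'E; move: q'n; rewrite q'E ltnNge nm.
rewrite ltnS leq_eqVlt => /orP[/eqP qm|qm].
  have -> : q = Ordinal mN by apply: val_inj.
  by rewrite eqxx E.
rewrite (E _ (ltnW qm)); case: eqP => [qE|_]; last exact: yg.
by move: qm; rewrite qE ltnn.
Qed.

Hypothesis e_unit : forall P, class_mx col pos G e P \in unitmx.
Hypothesis G_unit : forall j, G j \in unitmx.
Hypothesis G_quot : forall c j, exists c', G c = G c' *m G j.

(** In a linear relation between the rows, the last moving point with a nonzero coefficient would
    lie in a span it has to avoid. Only fixed points remain, and these are independent by
    [e_unit]. *)
Lemma mixed_unitmx x (P : {ffun 'I_k.+1 -> 'S_r.+1}) (rho : pred 'I_N) (f : 'I_N -> 'I_N) :
    generic_family x -> {in rho &, injective f} -> {in predC rho &, injective f} ->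
  \matrix_i ((if rho i then e (f i) else x (f i)) *m G (class_of col pos P (f i)))
    \in unitmx.
Proof.
move=> xg f1 f2; set Z := \matrix_i _.
have ZE i : row i Z = (if rho i then e (f i) else x (f i)) *m G (class_of col pos P (f i)).
  by rewrite rowK.
rewrite -row_free_unit; apply: inj_row_free => la laZ.
have la_moving i : ~~ rho i -> la 0 i = 0.
  move=> ri; apply/eqP; apply: contraT => lai.
  pose S := [pred i | ~~ rho i && (la 0 i != 0)].
  have Si : S i by rewrite /S /= ri.
  case: (@arg_maxnP _ i S (fun i => f i) Si) => {i ri lai Si} i /andP[ri lai] imax.
  pose j := class_of col pos P (f i).
  (* Factoring [G j] out of every row leaves [x (f i)] itself as a combination of translates. *)
  have [c cE] : exists c, forall l, G (class_of col pos P (f l)) = G (c l) *m G j.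
    exact: (fin_all_exists (fun l => G_quot (class_of col pos P (f l)) j)).
  pose Q : 'M[R]_N := \matrix_l (if (l == i) || (la 0 l == 0) then 0 else
    (if rho l then e (f l) else x (f l)) *m G (c l)).
  have QE l : row l Q = if (l == i) || (la 0 l == 0) then 0 else
    (if rho l then e (f l) else x (f l)) *m G (c l) by rewrite rowK.
  have QL l : row l Q \in translates x (f i).
    rewrite QE; case: ifP => [_|]; first by rewrite inE eqxx.
    move/negbT; rewrite negb_or => /andP[li lal].
    case: ifP => [_|/negbT rl]; first exact: translates_fixed.
    have := imax l; rewrite /S /= rl lal => /(_ isT) le_li.
    apply: translates_moving; rewrite ltn_neqAle le_li andbT.
    by apply: contra li => /eqP/val_inj/(f2 _ _ rl ri) ->.
  have Q0 : exists l, row l Q = 0 by exists i; rewrite QE eqxx.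
  case/negP: (xg _ _ QL Q0).
  have : x (f i) *m G j = (- (la 0 i)^-1 *: la) *m Q *m G j.
    have : la 0 i *: row i Z = - (la *m (Q *m G j)).
      apply/eqP; rewrite -addr_eq0 -laZ !mulmx_sum_row (bigD1 i) //=.
      rewrite row_mul QE eqxx /= mul0mx scaler0 add0r [in eqbRHS](bigD1 i) //=.
      apply/eqP; congr (_ + _); apply: eq_bigr => l /negPf li.
      rewrite row_mul QE li /=; case: eqP => [->|_]; first by rewrite !scale0r.
      by rewrite /= -mulmxA -cE ZE.
    rewrite ZE (negPf ri) -/j => h.
    by rewrite -!scalemxAl -mulmxA scaleNr -scalerN -h scalerA mulVf ?scale1r.
  move/(can_inj (mulmxK (G_unit j))) => ->; exact: submxMl.
apply/rowP => i; rewrite mxE.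
case: (boolP (rho i)) => ri; last exact: la_moving.
(* The coefficients carried along [f] form a relation between the rows of the fixed matrix. *)
pose mu : 'rV[R]_N := \row_q \sum_(l | rho l && (f l == q)) la 0 l.
have mu0 : mu = 0.
  rewrite -(mulmxK (e_unit P) mu) (_ : mu *m _ = 0) ?mul0mx // -laZ.
  rewrite !mulmx_sum_row [RHS](bigID rho) /= [X in _ + X]big1 ?addr0; last first.
    by move=> l /la_moving ->; rewrite scale0r.
  rewrite [RHS](partition_big f predT) //=; apply: eq_bigr => q _.
  rewrite mxE scaler_suml; apply: eq_bigr => l /andP[rl /eqP <-].
  by rewrite rowK ZE rl.
have /rowP/(_ (f i)) := mu0; rewrite !mxE (bigD1 i) /= ?ri ?eqxx // big1 ?addr0 //.
move=> l /andP[/andP[rl /eqP fl] /eqP li]; case: li; exact: f1.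
Qed.

Hypothesis pos_max : forall q, pos q != ord_max.
Hypothesis col_pos_inj : forall q q', col q = col q' -> pos q = pos q' -> q = q'.
Hypothesis odd_classes : odd r.+1.
Variable g : 'M[R]_N.
Hypothesis G_ordS : forall j, G (ordS j) = G j *m g.
Hypothesis det_g : 0 < \det g.

(** The points of [x] are replaced by those of [e] one at a time, and each replacement changes the
    degree by a multiple of [r.+1]. *)
Lemma degree_generic x u : generic_family x -> generic_to (translates x N) u ->
  (r.+1 %| degree col pos G x u - degree col pos G e u)%Z.
Proof.
move=> xg ug; pose mix (s : nat) (q : 'I_N) := if (q < s)%N then e q else x q.
suff H s : (s <= N)%N -> (r.+1 %| degree col pos G x u - degree col pos G (mix s) u)%Z.
  have := H N (leqnn _); congr (_ %| _ - _)%Z; apply: eq_bigr => P _.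
  congr (_ * cone_sign _ _); apply/row_matrixP => q; rewrite !rowK.
  by rewrite /mix ltn_ord.
elim: s => [_|s IH sN].
  by rewrite (_ : degree _ _ _ (mix 0) u = degree col pos G x u) ?subrr.
rewrite -(subrKA (degree col pos G (mix s) u)) rpredD ?IH 1?ltnW //.
pose s' := Ordinal sN.
have mixL q j : mix s q *m G j \in translates x N.
  by rewrite /mix; case: ifP => _; rewrite ?translates_fixed // translates_moving.
apply: (degree_move pos_max col_pos_inj odd_classes G_ordS det_g (s := s')).
  move=> q; rewrite -val_eqE /mix ltnS leq_eqVlt => /negPf /= ->.
  by [].
move=> P; set M := class_mx col pos G (mix s) P.
have -> : mix s.+1 s' = e s' by rewrite /mix ltnSn.
pose a := e s' *m G (class_of col pos P s').
have uM : M \in unitmx.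
  rewrite (_ : M = \matrix_i ((if (i < s)%N then e i else x i) *m G (class_of col pos P i))).
    by apply: (@mixed_unitmx x P (fun i : 'I_N => i < s)%N id) => // ? ? _ _.
  by [].
have ME q : row q M = mix s q *m G (class_of col pos P q) by rewrite rowK.
pose al := a *m invmx M; pose t := u *m invmx M.
have aE : a = al *m M by rewrite mulmxKV.
have uE : u = t *m M by rewrite mulmxKV.
clearbody al t.
have al0 (q : 'I_N) : al 0 q != 0.
  apply: contraT; rewrite negbK => /eqP alq.
  (* By Cramer's rule [al 0 q] vanishes only if this matrix is singular. It is again a mixed matrix:
     [f] puts the fixed point [s'] in row [q]. *)
  have : set_row M q a \in unitmx.
    pose rho (i : 'I_N) := (i < s)%N || (i == q); pose f (i : 'I_N) := if i == q then s' else i.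
    rewrite (_ : set_row _ _ _ =
      \matrix_i ((if rho i then e (f i) else x (f i)) *m G (class_of col pos P (f i)))).
      apply: (@mixed_unitmx x P rho f) => // i l; rewrite !unfold_in /= /rho /f.
        case: (i =P q) => [->|_]; case: (l =P q) => [->|_]; rewrite ?orbF ?orbT //.
        - by move=> _ ls E; move: ls; rewrite -E /= ltnn.
        - by move=> ls _ E; move: ls; rewrite E /= ltnn.
      by case: (i =P q) => [->|_]; case: (l =P q) => [->|_]; rewrite ?orbF ?orbT.
    apply/row_matrixP => i; rewrite row_set_row ME [RHS]rowK /rho /f /mix.
    by case: eqP; rewrite ?orbT ?orbF.
  by rewrite aE unitmxE det_set_row alq mul0r unitr0.
exists al, t; split => //; first split => //.
- apply: generic_coord_neq0 ug (mem_head _ _) _ uE => i.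
  by rewrite ME mixL.
- move=> q q' qq'; apply/eqP => E.
  (* If the ratios at [q] and [q'] agreed, subtracting [w *: al] from [t] would cancel both
     coordinates, and [u] would lie in the span of [a] and the rows other than [q] and [q']. *)
  pose w := t 0 q / al 0 q; pose c := t - w *: al + w *: delta_mx 0 q.
  have cq : c 0 q = w by rewrite !mxE !eqxx mulr1 /w divfK // subrr add0r.
  have cq' : c 0 q' = 0.
    rewrite !mxE !eqxx /= [q' == q]eq_sym (negPf qq') mulr0 addr0 /w mulrAC E.
    by rewrite mulfK // subrr.
  pose Q := set_row (set_row M q a) q' 0.
  have QL i : row i Q \in translates x N.
    rewrite !row_set_row ME; case: eqP => _; first exact: mem_head.
    by case: eqP => _; rewrite ?mixL ?translates_fixed.
  have Q0 : exists i, row i Q = 0 by exists q'; rewrite row_set_row eqxx.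
  case/negP: (ug _ QL Q0); rewrite (_ : u = c *m Q) ?submxMl //.
  rewrite !mul_set_row cq cq' scale0r addr0 /c mulmxDl mulmxBl -!scalemxAl -rowE.
  by rewrite -aE -uE scalerBr -addrA [w *: row _ _ + _]addrC !subrK.
Qed.

End Genericity.

(** * The model configuration *)

Section ModelColouring.
Variables (R : realFieldType) (k r : nat).
Local Notation N := (k.+1 * r)%N.
Local Notation colouring := {ffun 'I_k.+1 -> 'S_r.+1}.

(* The points are indexed by the entries of a (k+1) x r matrix, one row for
   each colour, and the vectors attached to them are flattened matrices of the
   same shape, i.e. tensors (coordinates of the point) * (vertex of the class). *)
Definition point_index (q : 'I_N) : 'I_k.+1 * 'I_r :=
  enum_val (cast_ord (esym (mxvec_cast k.+1 r)) q).
Definition point_colour q := (point_index q).1.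
Definition point_rank q : 'I_r.+1 := widen_ord (leqnSn r) (point_index q).2.

Lemma mxvec_indexK i a : point_index (mxvec_index i a) = (i, a).
Proof. by rewrite /point_index /mxvec_index cast_ordK enum_rankK. Qed.

Lemma point_indexK q : mxvec_index (point_index q).1 (point_index q).2 = q.
Proof. by case/mxvec_indexP: q => i a; rewrite mxvec_indexK. Qed.

Lemma point_rank_max q : point_rank q != ord_max.
Proof. by rewrite -val_eqE /= ltn_eqF. Qed.

Lemma point_colour_rank_inj q q' :
  point_colour q = point_colour q' -> point_rank q = point_rank q' -> q = q'.
Proof.
move=> c /(congr1 val) /= p; rewrite -(point_indexK q) -(point_indexK q').
by congr mxvec_index => //; apply: val_inj.
Qed.

(* The vertices of a simplex with barycentre [0]. *)
Definition vertex (j : 'I_r.+1) : 'rV[R]_r :=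
  \row_a ((j == a :> nat)%:R - (j == r :> nat)%:R).

Lemma vertex_widen (a : 'I_r) : vertex (widen_ord (leqnSn r) a) = delta_mx 0 a.
Proof.
apply/rowP => b; rewrite !mxE /= [_ == r]ltn_eqF // subr0.
by rewrite eq_sym.
Qed.

Lemma sum_vertex (c : 'I_r.+1 -> R) :
  \sum_j c j *: vertex j = \row_a (c (widen_ord (leqnSn r) a) - c ord_max).
Proof.
apply/rowP => a; rewrite summxE mxE big_ord_recr /= (bigD1 a) //= big1.
  rewrite !mxE eqxx /= [_ == r]ltn_eqF // eqxx gtn_eqF // subr0 mulr1 addr0.
  by rewrite sub0r mulrN1.
move=> b ba; rewrite !mxE /= [_ == r]ltn_eqF // subr0.
by rewrite (inj_eq val_inj) (negPf ba) mulr0.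
Qed.

Lemma sum_vertex_perm (s : 'S_r.+1) : \sum_j vertex (s j) = 0.
Proof.
rewrite -(reindex_inj (@perm_inj _ s) (P := predT) (F := vertex)) /=.
under eq_bigr do rewrite -[vertex _]scale1r.
by rewrite sum_vertex; apply/rowP => a; rewrite !mxE subrr.
Qed.

Definition rot_vertex : 'M[R]_r :=
  \matrix_a vertex (ordS (widen_ord (leqnSn r) a)).

(** True by construction for the first [r] vertices; for the last one because the vertices and their
    images both sum to [0]. *)
Lemma vertex_rot j : vertex j *m rot_vertex = vertex (ordS j).
Proof.
have W a : vertex (widen_ord (leqnSn r) a) *m rot_vertex =
    vertex (ordS (widen_ord (leqnSn r) a)) by rewrite vertex_widen -rowE rowK.
case: (unliftP ord_max j) => [a ->|->].
  rewrite (_ : lift _ _ = widen_ord (leqnSn r) a) ?W //.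
  by apply: val_inj; rewrite /= /bump leqNgt ltn_ord.
apply: (addrI (\sum_(a < r) vertex (ordS (widen_ord (leqnSn r) a)))).
rewrite -[in LHS](eq_bigr _ (fun a _ => W a)) -mulmx_suml -mulmxDl.
have := sum_vertex_perm 1; rewrite big_ord_recr /= perm1.
under eq_bigr do rewrite perm1; move=> ->; rewrite mul0mx.
have := sum_vertex_perm (cyclic_perm r); rewrite big_ord_recr /= permE.
by under eq_bigr do rewrite permE; move=> ->.
Qed.

Definition rotation : 'M[R]_N := lin_mulmxr rot_vertex.

Definition rotation_pow (m : nat) : 'M[R]_N := iter m (mulmxr rotation) 1%:M.

Lemma rotation_powS m : rotation_pow m.+1 = rotation_pow m *m rotation.
Proof. by []. Qed.

Lemma rotation_powD m n : rotation_pow (m + n) = rotation_pow m *m rotation_pow n.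
Proof.
elim: n => [|n IH]; first by rewrite addn0 mulmx1.
by rewrite addnS !rotation_powS IH mulmxA.
Qed.

Lemma mul_rotation_pow (y : 'cV[R]_k.+1) j m :
  mxvec (y *m vertex j) *m rotation_pow m = mxvec (y *m vertex (iter m (@ordS _) j)).
Proof.
elim: m => [|m IH]; first by rewrite mulmx1.
by rewrite rotation_powS mulmxA IH mul_vec_lin /= -mulmxA vertex_rot.
Qed.

Lemma iter_ordS m (j : 'I_r.+1) : val (iter m (@ordS _) j) = ((j + m) %% r.+1)%N.
Proof.
elim: m => [|m IH]; first by rewrite addn0 modn_small.
by rewrite iterS /= IH -addn1 modnDml -addnA addn1.
Qed.

Lemma rotation_pow_period : rotation_pow r.+1 = 1%:M.
Proof.
apply/row_matrixP => q; rewrite !rowE mulmx1.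
rewrite -(point_indexK q) -mxvec_delta -(mul_delta_mx (0 : 'I_1)) -vertex_widen.
rewrite mul_rotation_pow; congr (mxvec (_ *m vertex _)).
by apply: val_inj; rewrite iter_ordS modnDr modn_small.
Qed.

Lemma rotation_pow_mod m : rotation_pow (m %% r.+1) = rotation_pow m.
Proof.
rewrite [in RHS](divn_eq m r.+1) rotation_powD.
suff -> : rotation_pow (m %/ r.+1 * r.+1) = 1%:M by rewrite mul1mx.
by elim: (m %/ _)%N => // n IH; rewrite (mulSn n r.+1) rotation_powD IH rotation_pow_period mulmx1.
Qed.

Lemma rotation_pow_ordS (j : 'I_r.+1) :
  rotation_pow (ordS j) = rotation_pow j *m rotation.
Proof. by rewrite /= rotation_pow_mod. Qed.

Lemma rotation_pow_quot (c j : 'I_r.+1) :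
  exists c' : 'I_r.+1, rotation_pow c = rotation_pow c' *m rotation_pow j.
Proof.
exists (inord ((c + (r.+1 - j)) %% r.+1)); rewrite inordK ?ltn_pmod //.
rewrite rotation_pow_mod -rotation_powD -addnA subnK 1?ltnW //.
by rewrite rotation_powD rotation_pow_period mulmx1.
Qed.

Lemma rotation_pow_unit (j : 'I_r.+1) : rotation_pow j \in unitmx.
Proof.
apply: (mulmx1_unit (B := rotation_pow (r.+1 - j)) _).1.
by rewrite -rotation_powD subnKC ?rotation_pow_period // ltnW.
Qed.

(** An odd power of the determinant is [1]. *)
Lemma det_rotation_gt0 : odd r.+1 -> 0 < \det rotation.
Proof.
move=> odd_p; have E m : \det (rotation_pow m) = \det rotation ^+ m.
  elim: m => [|m IH]; first by rewrite det1.
  by rewrite rotation_powS det_mulmx IH exprSr.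
have := E r.+1; rewrite rotation_pow_period det1 => h.
by rewrite -(exprn_odd_gt0 _ odd_p) -h ltr01.
Qed.

(** All points of one colour coincide, at a basis vector. They start in class [ord0], and
    [rotation_pow] carries them to the other classes. *)
Definition model_point (q : 'I_N) : 'rV[R]_N :=
  mxvec (delta_mx (point_colour q) (0 : 'I_1) *m vertex ord0).

Definition place (v : 'I_N -> 'rV[R]_N) (P : colouring) :=
  class_mx point_colour point_rank (fun j : 'I_r.+1 => rotation_pow j) v P.

Lemma row_place_tensor (y : 'I_N -> 'cV[R]_k.+1) P q :
  row q (place (fun q => mxvec (y q *m vertex ord0)) P) =
  mxvec (y q *m vertex (class_of point_colour point_rank P q)).
Proof.
rewrite rowK mul_rotation_pow; congr (mxvec (_ *m vertex _)).
by apply: val_inj; rewrite iter_ordS add0n modn_small.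
Qed.

End ModelColouring.

(** * The degree of the model configuration *)

Section ModelDegree.
Variables (R : realFieldType) (k r : nat).
Local Notation N := (k.+1 * r)%N.
Local Notation colouring := {ffun 'I_k.+1 -> 'S_r.+1}.
Local Notation colour := (@point_colour k r).
Local Notation rank := (@point_rank k r).
Local Notation model := (@model_point R k r).

Lemma row_model (P : colouring) q :
  row q (place model P) =
  mxvec (delta_mx (colour q) (0 : 'I_1) *m vertex R (class_of colour rank P q)).
Proof. exact: row_place_tensor. Qed.

Lemma sum_point_index (V : nmodType) (F : 'I_N -> V) :
  \sum_q F q = \sum_i \sum_a F (mxvec_index i a).
Proof.
by rewrite pair_bigA /= (reindex _ (curry_mxvec_bij _ _)); apply: eq_bigr => -[].
Qed.

Lemma vec_mx_mul_model (P : colouring) (t : 'rV[R]_N) :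
  vec_mx (t *m place model P) =
  \matrix_i (\sum_a t 0 (mxvec_index i a) *: vertex R (P i (widen_ord (leqnSn r) a))).
Proof.
apply/matrixP => i b; rewrite mulmx_sum_row linear_sum summxE sum_point_index /=.
rewrite (bigD1 i) //= [X in _ + X]big1 ?addr0; last first.
  move=> l li; apply: big1 => a _; rewrite row_model linearZ /= mxvecK mxE.
  rewrite [X in _ * X]mxE big_ord1 [X in _ * (X * _)]mxE.
  by rewrite /point_colour mxvec_indexK eq_sym (negPf li) mul0r mulr0.
rewrite mxE summxE; apply: eq_bigr => a _; rewrite row_model linearZ /= mxvecK mxE.
rewrite [X in _ * X]mxE big_ord1 [X in _ * (X * _)]mxE.
by rewrite /class_of /point_colour /point_rank mxvec_indexK eqxx mul1r [RHS]mxE.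
Qed.

(** Since the vertices sum to [0], the vertex left out in a colour is minus the sum of the others:
    the swap replaces row [q] by minus the sum of the rows of its colour. *)
Lemma det_model_swap (P : colouring) q :
  \det (place model (swap_out colour rank q P)) = - \det (place model P).
Proof.
set M := place model P; set i := colour q.
pose b : 'rV[R]_N := \row_q' - (colour q' == i)%:R.
suff -> : place model (swap_out colour rank q P) = set_row M q (b *m M).
  by rewrite det_set_row mxE eqxx mulN1r.
apply/row_matrixP => q'; rewrite row_set_row row_model; case: eqVneq => [->|qq'].
  rewrite class_of_swap_out; apply: (can_inj vec_mxK); rewrite vec_mx_mul_model mxvecK.
  apply/row_matrixP => l; rewrite rowK row_mul.
  have -> : row l (delta_mx i (0 : 'I_1)) = (l == i)%:R *: (1%:M : 'M[R]_1).
    by apply/rowP => j; rewrite !mxE (ord1 j) eqxx mulr1 andbT.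
  rewrite -scalemxAl mul1mx; under [RHS]eq_bigr => a _ do
    rewrite mxE /point_colour mxvec_indexK /=.
  rewrite -scaler_sumr /= scaleNr -scalerN; case: eqP => [->|]; last by rewrite !scale0r.
  have := sum_vertex_perm R (P i); rewrite /i big_ord_recr /= => /eqP.
  by rewrite addrC addr_eq0 => /eqP ->.
rewrite class_of_swap ?row_model //; [exact: point_rank_max|exact: point_colour_rank_inj].
Qed.

Lemma colouring_sign_sqr (P : colouring) : colouring_sign P * colouring_sign P = 1.
Proof.
by rewrite /colouring_sign -big_split /= big1 // => i _; rewrite -expr2 sqrr_sign.
Qed.

(** After multiplication by the sign, [f] is invariant under all swaps; the transpositions with
    [ord_max] generate the symmetric group, so it is constant. *)
Lemma sign_fun_colouring (f : colouring -> R) :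
    (forall P q, f (swap_out colour rank q P) = - f P) ->
  forall P, f P = (colouring_sign P)%:~R * f [ffun=> 1%g].
Proof.
move=> f_swap; pose h P := (colouring_sign P)%:~R * f P.
have sgn2 := colouring_sign_sqr.
have h_swap P q : h (swap_out colour rank q P) = h P.
  rewrite /h colouring_sign_swap; last exact: point_rank_max.
  by rewrite f_swap rmorphN mulNr mulrN opprK.
pose upd i (s : 'S_r.+1) (P : colouring) : colouring :=
  [ffun l => if l == i then (s * P l)%g else P l].
have h_upd i s P : h (upd i s P) = h P.
  (* The permutations that can be applied in colour [i] without changing [h] form a group. *)
  pose S := [set s' : 'S_r.+1 | [forall P, h (upd i s' P) == h P]]%SET.
  have SP s' : reflect (forall P, h (upd i s' P) = h P) (s' \in S).
    by rewrite inE; apply: (iffP forallP) => H P'; apply/eqP; apply: H.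
  have Sgroup : group_set S.
    apply/group_setP; split.
      by apply/SP => Q; congr h; apply/ffunP => l; rewrite ffunE mul1g; case: ifP.
    move=> s1 s2 /SP H1 /SP H2; apply/SP => Q.
    rewrite -(H2 Q) -[RHS]H1; congr h; apply/ffunP => l; rewrite !ffunE.
    by case: eqP => // _; rewrite mulgA.
  suff : s \in S by move/SP.
  have : s \in [set: 'S_r.+1]%SET by rewrite inE.
  rewrite -(gen_tperm ord_max); apply/fintype.subsetP: s.
  rewrite (gen_subG _ (Group Sgroup)); apply/fintype.subsetP => _ /imsetP[j _ ->].
  apply/SP => Q; case: (unliftP ord_max j) => [a ->|->]; last first.
    by rewrite tperm1; congr h; apply/ffunP => l; rewrite ffunE mul1g; case: ifP.
  rewrite -(h_swap Q (mxvec_index i a)); congr h; apply/ffunP => l.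
  rewrite !ffunE /point_colour /point_rank mxvec_indexK /= tpermC.
  congr (if _ then (tperm _ _ * _)%g else _); apply: val_inj.
  by rewrite /= /bump leqNgt ltn_ord.
(* The colours are reset to the identity one at a time. *)
pose trunc m (P : colouring) : colouring := [ffun l : 'I_k.+1 => if (l < m)%N then P l else 1%g].
have h_trunc m (P : colouring) : h (trunc m P) = h [ffun=> 1%g].
  elim: m => [|m IH]; first by congr h; apply/ffunP => l; rewrite !ffunE.
  rewrite -IH; case: (ltnP m k.+1) => mk; last first.
    congr h; apply/ffunP => l; rewrite !ffunE (leq_trans (ltn_ord l) mk).
    by rewrite (leq_trans (ltn_ord l)) // leqW.
  rewrite -[RHS](h_upd (Ordinal mk) (P (Ordinal mk))); congr h; apply/ffunP => l.
  rewrite !ffunE ltnS leq_eqVlt -val_eqE /=.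
  case: eqP => [lm|] //=; rewrite {1}lm ltnn mulg1; congr (P _); exact: val_inj.
move=> P; have : h P = h [ffun=> 1%g].
  rewrite -(h_trunc k.+1 P); congr h; apply/ffunP => l; rewrite ffunE ltn_ord.
  by [].
rewrite /h [colouring_sign [ffun=> _]]big1 ?mul1r => [<-|i _]; last first.
  by rewrite ffunE odd_perm1.
by rewrite mulrA -rmorphM sgn2 mul1r.
Qed.

Lemma det_model (P : colouring) : \det (place model P) = (colouring_sign P)%:~R.
Proof.
rewrite (@sign_fun_colouring (fun P => \det (place model P))).
  rewrite (_ : place model _ = 1%:M) ?det1 ?mulr1 //.
  apply/row_matrixP => q; rewrite row_model row1 /class_of ffunE perm1.
  by rewrite vertex_widen mul_delta_mx mxvec_delta point_indexK.
by move=> Q q; rewrite det_model_swap.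
Qed.

Lemma model_unit (P : colouring) : place model P \in unitmx.
Proof.
rewrite unitmxE det_model unitfE intr_eq0 /colouring_sign.
by apply/prodf_neq0 => i _; rewrite signr_eq0.
Qed.

(* Row i of [vec_mx u] is [\sum_j bary u i j *: vertex j]; these coordinates
   are determined up to adding a constant, normalized to vanish at [ord_max]. *)
Definition bary (u : 'rV[R]_N) (i : 'I_k.+1) (j : 'I_r.+1) : R :=
  if unlift ord_max j is Some a then u 0 (mxvec_index i a) else 0.

(** Shifting the coordinates of row [i] by a constant changes nothing, as the vertices sum to [0];
    the constant chosen removes the term of the class left out. *)
Lemma model_coord (u : 'rV[R]_N) (P : colouring) :
  u = (\row_q (bary u (colour q) (class_of colour rank P q) -
               bary u (colour q) (P (colour q) ord_max))) *m place model P.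
Proof.
apply: (can_inj vec_mxK); rewrite vec_mx_mul_model.
apply/row_matrixP => i; rewrite rowK.
pose c := bary u i (P i ord_max).
transitivity (\sum_j (bary u i j - c) *: vertex R j).
  rewrite sum_vertex; apply/rowP => a; rewrite !mxE.
  rewrite opprB addrA subrK /bary unlift_none subr0.
  rewrite (_ : widen_ord _ a = lift ord_max a) ?liftK //.
  by apply: val_inj; rewrite /= /bump leqNgt ltn_ord.
rewrite (reindex_inj (@perm_inj _ (P i))) big_ord_recr /= subrr scale0r addr0.
apply: eq_bigr => a _; rewrite mxE /class_of /point_colour /point_rank.
by rewrite mxvec_indexK.
Qed.

(** By symmetry the [r.+1] counts are equal, and together they count all permutations. *)
Lemma sum_perm_max (m : 'I_r.+1) : (\sum_(s : 'S_r.+1) (s ord_max == m) = r`!)%N.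
Proof.
pose K (m : 'I_r.+1) := (\sum_(s : 'S_r.+1) (s ord_max == m))%N.
have KE l : K l = K m.
  rewrite /K (reindex_inj (mulIg (tperm l m))) /=; apply: eq_bigr => s _.
  by rewrite permM (canF_eq (tpermK l m)) tpermL.
have : (\sum_l K l = r.+1`!)%N.
  rewrite exchange_big /= -card_Sn -sum1_card /=; apply: eq_bigr => s _.
  by rewrite (bigD1 (s ord_max)) //= eqxx big1 // => l /negPf; rewrite eq_sym => ->.
rewrite (eq_bigr (fun _ => K m)) => [|l _]; last exact: KE.
by rewrite sum_nat_const card_ord factS => /eqP; rewrite eqn_pmul2l // => /eqP.
Qed.

(* Only the colourings that leave out, in every colour, the class with the
   smallest coordinate of u contribute, each with sign 1. *)
Lemma degree_model (L : seq 'rV[R]_N) (u : 'rV[R]_N) :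
    generic_to L u -> 0 \in L -> (forall P q, row q (place model P) \in L) ->
  degree colour rank (fun j : 'I_r.+1 => rotation_pow R k r j) model u =
    (r`! ^ k.+1)%:Z.
Proof.
move=> ug L0 LM.
(* If the coordinates at [j] and [j'] agreed, a colouring that leaves out [j'] would give [u] a zero
   coordinate, against genericity. *)
have bary_inj i : injective (bary u i).
  move=> j j' E; apply/eqP; apply: contraT => jj'.
  pose P : colouring := [ffun=> tperm ord_max j'].
  case: (unliftP ord_max (tperm ord_max j' j)) => [a aE|/eqP]; last first.
    by rewrite (canF_eq (tpermK _ _)) tpermL (negPf jj').
  have := generic_coord_neq0 ug L0 (LM P) (model_coord u P) (mxvec_index i a).
  rewrite mxE /class_of /point_colour /point_rank mxvec_indexK ffunE tpermL.
  rewrite (_ : widen_ord _ _ = lift ord_max a) -?aE ?tpermK ?E ?subrr ?eqxx //.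
  by apply: val_inj; rewrite aE /= /bump leqNgt ltn_ord.
have [m mP] : exists m : 'I_k.+1 -> 'I_r.+1, forall i j, bary u i (m i) <= bary u i j.
  exists (fun i => [arg min_(j < ord0) bary u i j]%O) => i j.
  by case: arg_minP => // l _; apply.
have cone P : cone_sign (place model P) u =
    colouring_sign P * \prod_i (P i ord_max == m i)%:Z.
  have sgz_sg : sgz (colouring_sign P) = colouring_sign P.
    rewrite /colouring_sign; elim/big_rec: _ => // i x _ xE.
    by rewrite sgzM xE; case: (odd_perm _).
  have -> : cone_sign (place model P) u = colouring_sign P *
      [forall q, 0 <= bary u (colour q) (class_of colour rank P q) -
                      bary u (colour q) (P (colour q) ord_max)]%:R.
    rewrite /cone_sign det_model sgz_int sgz_sg {1}(model_coord u P).
    rewrite (mulmxK (model_unit P)); congr (_ * (nat_of_bool _)%:R).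
    by apply: eq_forallb => q; rewrite mxE.
  have -> : \prod_i (P i ord_max == m i)%:Z =
      (\big[andb/true]_i (P i ord_max == m i))%:Z.
    by elim/big_rec2: _ => // i b x _ ->; case: (_ == _); case: b.
  congr (_ * _); rewrite big_andE natz; congr (nat_of_bool _)%:Z; apply/forallP/forallP => H.
    move=> i; apply/eqP/(bary_inj i)/le_anti; rewrite mP andbT.
    case: (unliftP ord_max ((P i)^-1%g (m i))) => [a aE|aE].
      have := H (mxvec_index i a).
      rewrite subr_ge0 /class_of /point_colour /point_rank mxvec_indexK /=.
      rewrite (_ : widen_ord _ _ = (P i)^-1%g (m i)) ?permKV //.
      by apply: val_inj; rewrite aE /= /bump leqNgt ltn_ord.
    by rewrite -aE permKV.
  by move=> q; rewrite subr_ge0 (eqP (H _)) mP.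
rewrite /degree; under eq_bigr => P _ do
  rewrite -/(place model P) cone mulrA colouring_sign_sqr mul1r.
(* The choices in the different colours are independent. *)
rewrite -(bigA_distr_bigA (fun i (s : 'S_r.+1) => (s ord_max == m i)%:Z)) /=.
have E i : \sum_(s : 'S_r.+1) (s ord_max == m i)%:Z = r`!%:Z.
  by rewrite -(sum_perm_max (m i)) -!natz natr_sum; apply: eq_bigr => s _; rewrite natz.
under eq_bigr do rewrite E.
by rewrite prodr_const card_ord -!natz natrX.
Qed.

End ModelDegree.

(** * A cone containing a generic vector *)

Section GenericSolution.
Variables (R : realFieldType) (k r : nat).
Local Notation N := (k.+1 * r)%N.
Local Notation colouring := {ffun 'I_k.+1 -> 'S_r.+1}.
Local Notation rot := (fun j : 'I_r.+1 => rotation_pow R k r j).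
Hypothesis r1_prime : prime r.+1.
Hypothesis r1_odd : odd r.+1.

(** By Wilson's theorem [r.+1] divides [r! + 1]. *)
Lemma prime_ndvd_fact_exp m : ~~ (r.+1 %| r`! ^ m)%N.
Proof.
apply/negP => h; have : (r.+1 %| r`!)%N.
  by case: m h => [|m]; [rewrite dvdn1 => /eqP r0; have := r1_prime; rewrite r0|
    rewrite Euclid_dvdX // => /andP[]].
have := Wilson (prime_gt1 r1_prime); rewrite r1_prime /= => /esym h1 h2.
have : (r.+1 %| 1)%N by rewrite -(dvdn_addr 1 h2) addn1.
by rewrite dvdn1 => /eqP r0; have := r1_prime; rewrite r0.
Qed.

Lemma generic_solution (x : 'I_N -> 'rV[R]_N) (u : 'rV[R]_N) :
    generic_family rot (@model_point R k r) x ->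
    generic_to (translates rot (@model_point R k r) x N) u ->
  exists (P : colouring) (t : 'rV[R]_N),
    (forall q, 0 <= t 0 q) /\ u = t *m place x P.
Proof.
move=> xg ug.
have deg := degree_generic (@model_unit R k r) (@rotation_pow_unit R k r)
  (@rotation_pow_quot R k r) (@point_rank_max k r) (@point_colour_rank_inj k r)
  r1_odd (@rotation_pow_ordS R k r) (det_rotation_gt0 R k r1_odd) xg ug.
have [P cP] : exists P, cone_sign (place x P) u != 0.
  apply/existsP; apply: contraT; rewrite negb_exists => /forallP c0.
  have dx : degree (@point_colour k r) (@point_rank k r) rot x u = 0.
    by apply: big1 => P _; have := c0 P; rewrite negbK => /eqP ->; rewrite mulr0.
  move: deg; rewrite dx (degree_model ug) ?mem_head //; last first.
    by move=> P q; rewrite rowK translates_fixed.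
  rewrite sub0r rpredN dvdzE !absz_nat.
  by rewrite (negPf (prime_ndvd_fact_exp _)).
move: cP; rewrite /cone_sign mulf_eq0 negb_or sgz_eq0 -unitfE => /andP[dx].
case: forallP => // t_ge0 _; exists P, (u *m invmx (place x P)); split => //.
by rewrite mulmxKV.
Qed.

End GenericSolution.

(** * Colourful Tverberg *)

Section Limit.
Variable R : realType.

Definition simplex n (z : 'rV[R]_n) : Prop :=
  (forall i, 0 <= z 0 i) /\ \sum_i z 0 i = 1.

Lemma continuous_sum_coord n (w : 'I_n -> R) :
  continuous (fun z : 'rV[R]_n => \sum_i z 0 i * w i).
Proof.
move=> z; have F : Filter (nbhs z) by exact: nbhs_filter.
apply: cvg_big => [|i _]; first exact: add_continuous.
by apply: cvgM; [exact: coord_continuous|exact: cvg_cst].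
Qed.

Lemma simplex_compact n : compact [set z : 'rV[R]_n | simplex z].
Proof.
have -> : [set z : 'rV[R]_n | simplex z] =
    [set z : 'rV[R]_n | forall i, `[0, 1]%classic (z ord0 i)] `&`
    (fun z : 'rV[R]_n => \sum_i z 0 i * 1) @^-1` [set x | x = 1].
  have E (z : 'rV[R]_n) : \sum_i z 0 i * 1 = \sum_i z 0 i.
    by apply: eq_bigr => i _; rewrite mulr1.
  apply/seteqP; split => z /=.
    move=> [z0 z1]; split; last by rewrite E.
    move=> i; rewrite in_itv /= z0 -z1 (bigD1 i) //= lerDl; exact: sumr_ge0.
  move=> [z01]; rewrite E; split => // i.
  by have := z01 i; rewrite in_itv /= => /andP[].
apply: compact_closedI; first exact: (rV_compact (fun=> @segment_compact R 0 1)).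
apply: preimage_closed; last exact: closed_eq.
by move=> z _; exact: continuous_sum_coord.
Qed.

(** A positive continuous function on a compact set has a positive minimum; the simplex is empty for
    [n = 0], where any constant serves. *)
Lemma simplex_margin n m (W : 'M[R]_(n, m)) :
    (forall z, simplex z -> z *m W != 0) ->
  exists2 c, 0 < c & forall z, simplex z -> c <= \sum_j `|(z *m W) 0 j|.
Proof.
move=> W0; pose f (z : 'rV[R]_n) := \sum_j `|\sum_i z 0 i * W i j|.
have fE z : f z = \sum_j `|(z *m W) 0 j| by apply: eq_bigr => j _; rewrite mxE.
have [[z0 z0S]|nS] := pselect (exists z : 'rV[R]_n, simplex z); last first.
  by exists 1 => // z zS; case: nS; exists z.
have fc : continuous f.
  move=> z; have F : Filter (nbhs z) by exact: nbhs_filter.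
  apply: cvg_big => [|j _]; first exact: add_continuous.
  by apply: cvg_norm; exact: continuous_sum_coord.
have := @compact_EVT_min _ _ f _ (ex_intro _ z0 z0S) (@simplex_compact n)
  (continuous_subspaceT fc).
move=> [c /set_mem cS cmin]; exists (f c); last first.
  by move=> z zS; rewrite -fE; apply: cmin; rewrite inE.
rewrite lt_def; apply/andP; split; last by rewrite sumr_ge0.
apply: contra (W0 c cS); rewrite fE psumr_eq0 // => /allP h.
apply/eqP/rowP => j; rewrite [RHS]mxE; apply/eqP; rewrite -normr_eq0.
by apply: h; rewrite mem_index_enum.
Qed.

(** Otherwise the finitely many [W P] have a common margin [c0], which a small enough perturbation
    of the entries cannot absorb. *)
Lemma simplex_limit (I : finType) n m (W : I -> 'M[R]_(n, m)) :
    (forall d, 0 < d -> exists P (W' : 'M[R]_(n, m)) z,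
      [/\ forall i j, `|W' i j - W P i j| <= d, simplex z & z *m W' = 0]) ->
  exists P z, simplex z /\ z *m W P = 0.
Proof.
move=> approx; apply: contrapT => none.
have margin P : exists c : R, 0 < c /\
    forall z, simplex z -> c <= \sum_j `|(z *m W P) 0 j|.
  have [|c c0 cP] := @simplex_margin _ _ (W P); last by exists c.
  by move=> z zS; apply/eqP => zW; apply: none; exists P, z.
have [c cP] := fin_all_exists margin.
pose c0 := \big[Order.min/1]_P c P.
have c0_gt0 : 0 < c0 by rewrite /c0; elim/big_rec: _ => // P x _ x0; rewrite lt_min x0 (cP P).1.
(* Dividing by [m.+1] keeps the total error [m%:R * d] strictly below [c0]. *)
pose d := c0 / (m.+1)%:R.
have d0 : 0 < d by rewrite divr_gt0 ?ltr0Sn.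
have [P [W' [z [W'W zS zW']]]] := approx d d0.
have := (cP P).2 z zS; rewrite leNgt => /negP; apply.
apply: (@le_lt_trans _ _ (m%:R * d)); last first.
  apply: (@lt_le_trans _ _ c0); last by rewrite /c0; exact: bigmin_le_cond.
  by rewrite /d mulrA ltr_pdivrMr ?ltr0Sn // mulrC ltr_pM2l // ltr_nat.
rewrite mulr_natl -[X in _ *+ X](card_ord m) -sumr_const; apply: ler_sum => j _.
have -> : (z *m W P) 0 j = - \sum_i z 0 i * (W' i j - W P i j).
  under eq_bigr do rewrite mulrBr; rewrite sumrB opprB.
  by have /rowP/(_ j) := zW'; rewrite !mxE => ->; rewrite subr0.
rewrite normrN; apply: le_trans (ler_norm_sum _ _ _) _.
rewrite -[leRHS]mul1r -zS.2 mulr_suml; apply: ler_sum => i _.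
by rewrite normrM (ger0_norm (zS.1 i)) ler_wpM2l ?zS.1.
Qed.

(** For generic points near [v], some cone contains a generic vector near [- u]. In the limit the
    coefficient of [u] may vanish, so the normalized solution gives [u] a coordinate of its own. *)
Lemma coloured_zero (k r : nat) (v : 'I_(k.+1 * r) -> 'rV[R]_(k.+1 * r)) (u : 'rV[R]_(k.+1 * r)) :
    prime r.+1 -> odd r.+1 ->
  exists (P : {ffun 'I_k.+1 -> 'S_r.+1}) (z : 'rV[R]_(1 + k.+1 * r)),
    simplex z /\ z *m col_mx u (place v P) = 0.
Proof.
move=> r1_prime r1_odd; set N := (k.+1 * r)%N in v u *.
apply: simplex_limit => d d0.
(* [B] bounds the entries of all rotations, so moving the points by [e] changes an entry of [place]
   by at most [N%:R * e * B <= d]. *)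
pose B : R := 1 + \sum_(j < r.+1) \sum_(a < N) \sum_(b < N) `|rotation_pow R k r j a b|.
have BP (j : 'I_r.+1) a b : `|rotation_pow R k r j a b| <= B.
  have le_sum n (F : 'I_n -> R) l : (forall i, 0 <= F i) -> F l <= \sum_i F i.
    by move=> F0; rewrite (bigD1 l) //= lerDl sumr_ge0.
  rewrite /B; apply: ler_wpDl => //.
  apply: le_trans (le_sum _ _ j _) => [|l]; last by do 2!apply: sumr_ge0 => ? _.
  apply: le_trans (le_sum _ _ a _) => [|l]; last by apply: sumr_ge0.
  exact: (le_sum _ (fun b => `|rotation_pow R k r j a b|)).
have B0 : 0 < B.
  by rewrite ltr_pwDl // sumr_ge0 // => ? _; apply: sumr_ge0 => ? _; exact: sumr_ge0.
pose e := Num.min d (d / (B * N.+1%:R)).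
have e0 : 0 < e by rewrite lt_min d0 divr_gt0 // mulr_gt0 ?ltr0Sn.
have [x xv xg] := exists_generic_family (fun j : 'I_r.+1 => rotation_pow R k r j)
  (@model_point R k r) v e0.
have [y yu yg] := exists_generic (translates (fun j : 'I_r.+1 => rotation_pow R k r j)
  (@model_point R k r) x N) (- u) e0.
have [P [t [t0 yE]]] := generic_solution r1_prime r1_odd xg yg.
pose s := 1 + \sum_q t 0 q; have s0 : 0 < s by rewrite ltr_pwDl // sumr_ge0.
exists P, (col_mx (- y) (place x P)), (s^-1 *: row_mx 1%:M t); split.
- move=> i j; case: (split_ordP i) => l ->.
    rewrite !col_mxEu (ord1 l); have := yu j; rewrite !mxE opprK -normrN opprD.
    by rewrite addrC => /le_trans; apply; rewrite /e ge_min lexx.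
  rewrite !col_mxEd !mxE -sumrB; apply: le_trans (ler_norm_sum _ _ _) _.
  apply: (@le_trans _ _ (\sum_(a < N) e * B)).
    apply: ler_sum => a _; rewrite -mulrBl normrM ler_pM //.
  rewrite sumr_const card_ord -mulr_natr.
  apply: (@le_trans _ _ (d / (B * N.+1%:R) * B * N%:R)).
    apply: ler_wpM2r => //; apply: ler_wpM2r; first exact: ltW.
    by rewrite /e ge_min lexx orbT.
  have -> : d / (B * N.+1%:R) * B * N%:R = d * (N%:R / N.+1%:R).
    have F (b c n : R) : b != 0 -> c != 0 -> d / (b * c) * b * n = d * (n / c).
      by move=> b0 c0; field; rewrite b0 c0.
    by rewrite F ?pnatr_eq0 ?gt_eqF.
  apply: ler_piMr; first exact: ltW.
  by rewrite ler_pdivrMr ?ltr0Sn // mul1r ler_nat.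
- split=> [i|].
    rewrite mxE; apply: mulr_ge0; first by rewrite invr_ge0 ltW.
    case: (split_ordP i) => l ->.
      by rewrite (ord1 l) (row_mxEl (1%:M : 'M[R]_1)) mxE eqxx ler0n.
    by rewrite row_mxEr.
  under eq_bigr do rewrite mxE; rewrite -mulr_sumr big_split_ord /= big_ord1.
  rewrite (row_mxEl (1%:M : 'M[R]_1)) mxE eqxx; under eq_bigr do rewrite row_mxEr.
  by rewrite mulVf // gt_eqF.
- by rewrite -scalemxAl mul_row_col mul1mx -yE addNr scaler0.
Qed.

End Limit.

Lemma sum_classes (I A J : finType) (V : nmodType) (c : I -> A -> J) (F : I -> A -> J -> V) :
  \sum_j \sum_i \sum_(a | c i a == j) F i a j = \sum_i \sum_a F i a (c i a).
Proof.
rewrite exchange_big; apply: eq_bigr => i _; rewrite [RHS](partition_big (c i) predT) //.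
by apply: eq_bigr => j _; apply: eq_bigr => a /eqP ->.
Qed.

(* The optimal colourful Tverberg theorem for one auxiliary point; dropping
   the class [ord_max] of that point leaves [r] classes. *)
Lemma colourful_tverberg (R : realType) (D r : nat) (g : 'I_D.+1 -> 'I_r -> 'rV[R]_D) :
    prime r.+1 -> (1 < r)%N ->
  exists (c : 'I_D.+1 -> 'I_r -> 'I_r.+1) (t : 'I_D.+1 -> 'I_r -> R)
         (s : R) (b : 'rV[R]_D),
    [/\ forall i, injective (c i), forall i a, 0 <= t i a, 0 < s &
        forall j, j != ord_max ->
          \sum_i \sum_(a | c i a == j) t i a = s /\
          \sum_i \sum_(a | c i a == j) t i a *: g i a = b].
Proof.
move=> r1_prime r_gt1.
have r1_odd : odd r.+1 by case/even_prime: r1_prime r_gt1 => // -[->].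
(* The last coordinate [1] records the weights. The auxiliary point [y0] is the lifted origin,
   placed in class [ord_max]. *)
pose y i a : 'cV[R]_D.+1 :=
  \col_l (if unlift ord_max l is Some l' then g i a 0 l' else 1).
pose y0 : 'cV[R]_D.+1 := delta_mx ord_max 0.
pose v q := mxvec (y (point_index q).1 (point_index q).2 *m vertex R (@ord0 r)).
have [P [z [[z0 z1] zW]]] := coloured_zero v (mxvec (y0 *m vertex R ord_max)) r1_prime r1_odd.
pose c (i : 'I_D.+1) (a : 'I_r) := P i (widen_ord (leqnSn r) a).
pose t i a := z 0 (rshift 1 (mxvec_index i a)).
pose s0 := z 0 (lshift _ ord0).
pose S j : 'cV[R]_D.+1 := \sum_i \sum_(a | c i a == j) t i a *: y i a +
  (j == ord_max)%:R *: (s0 *: y0).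
(* The zero combination reads [\sum_j S j *m vertex R j = 0]; the vertices satisfy no relation but
   the one with equal coefficients. *)
have Seq j : S j = S ord_max.
  case: (unliftP ord_max j) => [a ->|->//].
  have : \sum_j S j *m vertex R j = 0.
    apply: (can_inj mxvecK); rewrite linear0 -[RHS]zW.
    rewrite -[z in RHS]hsubmxK mul_row_col [X in X + _]mulmx_sum_row big_ord1 rowE.
    rewrite (_ : delta_mx 0 0 = 1%:M) ?mul1mx; last first.
      by apply/matrixP => i l; rewrite !mxE !ord1 eqxx.
    rewrite mulmx_sum_row sum_point_index mxE -/s0.
    under [in RHS]eq_bigr => i _ do under eq_bigr => l _ do
      rewrite mxE row_place_tensor mxvec_indexK /class_of /point_colour /point_rank
        mxvec_indexK /= -linearZ /=.
    have ES h : S h *m vertex R h =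
        \sum_i \sum_(l | c i l == h) t i l *: (y i l *m vertex R h) +
        (h == ord_max)%:R *: (s0 *: (y0 *m vertex R h)).
      rewrite /S mulmxDl -!scalemxAl mulmx_suml; congr (_ + _).
      apply: eq_bigr => i _; rewrite mulmx_suml; apply: eq_bigr => l _.
      by rewrite -scalemxAl.
    rewrite (eq_bigr _ (fun h _ => ES h)).
    rewrite big_split /= addrC linearD /=; congr (_ + _).
      rewrite (bigD1 ord_max) //= big1 ?addr0 => [|h /negPf ->]; last by rewrite scale0r.
      by rewrite eqxx scale1r linearZ.
    rewrite linear_sum -[RHS](sum_classes c
      (fun i a j => mxvec (t i a *: (y i a *m vertex R j)))) /=.
    apply: eq_bigr => h _; rewrite linear_sum; apply: eq_bigr => i _ /=.
    by rewrite linear_sum.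
  move=> /matrixP sum0; apply/colP => l; have := sum0 l a.
  have -> : (\sum_j S j *m vertex R j) l a = (\sum_j S j l 0 *: vertex R j) 0 a.
    rewrite !summxE; apply: eq_bigr => i _.
    by rewrite [LHS]mxE big_ord1 [RHS]mxE.
  rewrite sum_vertex [LHS]mxE [RHS]mxE => /eqP; rewrite subr_eq0 => /eqP <-.
  by congr (S _ l 0); apply: val_inj; rewrite /= /bump leqNgt ltn_ord.
have Smax j : S j ord_max 0 =
    \sum_i \sum_(a | c i a == j) t i a + (j == ord_max)%:R * s0.
  rewrite mxE summxE; congr (_ + _); last by rewrite !mxE !eqxx mulr1.
  apply: eq_bigr => i _; rewrite summxE; apply: eq_bigr => a _.
  by rewrite !mxE unlift_none mulr1.
(* The weights add up to [1], so each class has weight [1 / r.+1], positive even if [s0]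
   vanishes. *)
have Stot : r.+1%:R * S ord_max ord_max 0 = 1.
  rewrite mulr_natl -[X in _ *+ X](card_ord r.+1) -sumr_const.
  rewrite -[RHS]z1; under eq_bigr => j _ do rewrite -(Seq j) Smax.
  rewrite big_split /= (sum_classes c (fun i a _ => t i a)).
  rewrite [X in _ + X](bigD1 ord_max) //= eqxx mul1r.
  rewrite [X in _ + (_ + X)]big1 ?addr0 => [|j /negPf ->]; last by rewrite mul0r.
  by rewrite big_split_ord /= big_ord1 sum_point_index addrC.
exists c, t, (S ord_max ord_max 0), (\row_l S ord_max (lift ord_max l) 0); split.
- by move=> i a a' /perm_inj /(congr1 val) /= /val_inj.
- by move=> i a; exact: z0.
- rewrite -(pmulr_rgt0 _ (ltr0Sn R r)) Stot; exact: ltr01.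
- move=> j /negPf jm; split; first by rewrite -(Seq j) Smax jm mul0r addr0.
  apply/rowP => l; rewrite [RHS]mxE -(Seq j) [RHS]mxE jm scale0r mxE addr0 !summxE.
  apply: eq_bigr => i _; rewrite !summxE; apply: eq_bigr => a _.
  by rewrite !mxE liftK.
Qed.

(** In each colour [r] points are chosen through [h]. The other points and those in the dropped
    class get weight [0], hence the restriction of the rainbow condition to nonzero weights. *)
Lemma rainbow_tverberg (R : realType) (D r n m : nat) (G : 'I_n -> 'rV[R]_D)
    (col : 'I_n -> 'I_m) :
    prime r.+1 -> (1 < r)%N -> m = D.+1 ->
    (forall i, r <= #|[pred x | col x == i]|)%N ->
  exists (cls : 'I_n -> 'I_r) (T : 'I_n -> R) (s : R) (b : 'rV[R]_D),
    [/\ forall x, 0 <= T x, 0 < s,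
        forall x y, col x = col y -> cls x = cls y -> T x != 0 -> T y != 0 -> x = y &
        forall j, \sum_(x | cls x == j) T x = s /\
                  \sum_(x | cls x == j) T x *: G x = b].
Proof.
move=> r1_prime r_gt1 mD; subst m => col_r.
pose h i (a : 'I_r) : 'I_n := enum_val (widen_ord (col_r i) a).
have h_col i a : col (h i a) = i by have := enum_valP (widen_ord (col_r i) a); rewrite inE => /eqP.
have h_inj i a i' a' : h i a = h i' a' -> (i, a) = (i', a').
  move=> E; have ii : i = i' by rewrite -(h_col i a) E h_col.
  by subst i'; move: E => /enum_val_inj /(congr1 val) /= /val_inj ->.
have [c [t [s [b [c_inj t0 s0 cP]]]]] := colourful_tverberg (fun i a => G (h i a)) r1_prime r_gt1.
pose sel x := [pick p : 'I_D.+1 * 'I_r | h p.1 p.2 == x].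
have selK x p : sel x = Some p -> h p.1 p.2 = x.
  by rewrite /sel; case: pickP => // p' /eqP <- [<-].
have sel_h i a : sel (h i a) = Some (i, a).
  by rewrite /sel; case: pickP => [[i' a'] /= /eqP/h_inj ->|/(_ (i, a))]; rewrite //= eqxx.
pose j0 : 'I_r := Ordinal (ltnW r_gt1).
(* [j0] is a default class for points of weight [0]. *)
pose cls x := if sel x is Some p then odflt j0 (unlift ord_max (c p.1 p.2)) else j0.
pose T x := if sel x is Some p then (if c p.1 p.2 == ord_max then 0 else t p.1 p.2) else 0.
have sumE (V : lmodType R) (F : 'I_n -> V) j : \sum_(x | cls x == j) T x *: F x =
    \sum_i \sum_(a | c i a == lift ord_max j) t i a *: F (h i a).
  rewrite big_mkcond (bigID (fun x => sel x)) /= [X in _ + X]big1 ?addr0; last first.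
    by move=> x; rewrite /T; case: (sel x) => // _; rewrite scale0r if_same.
  rewrite (reindex_omap (fun p => h p.1 p.2) sel) /=; last first.
    by move=> x; case E: (sel x) => [p|] //= _; rewrite (selK _ _ E).
  under eq_bigl => p do rewrite sel_h -surjective_pairing eqxx /=.
  under [RHS]eq_bigr => i _ do rewrite big_mkcond.
  rewrite pair_bigA /=; apply: eq_bigr => -[i a] _ /=.
  rewrite /cls /T sel_h /=; case: unliftP => [j' ->|->] /=.
    by rewrite (inj_eq lift_inj) [lift _ _ == ord_max]eq_sym (negPf (neq_lift _ _)).
  by rewrite eqxx scale0r if_same (negPf (neq_lift _ _)).
exists cls, T, s, b; split => //.
- by move=> x; rewrite /T; case: (sel x) => // p; case: ifP.
- move=> x y; rewrite /T /cls.
  case Ex: (sel x) => [[i a]|]; last by rewrite eqxx.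
  case Ey: (sel y) => [[i' a']|] /=; last by rewrite eqxx.
  rewrite -(selK _ _ Ex) -(selK _ _ Ey) /= !h_col => <-.
  case: (unliftP ord_max (c i a)) => [j ca|->]; last by rewrite !eqxx.
  case: (unliftP ord_max (c i a')) => [j' ca'|->]; last by rewrite !eqxx.
  by move=> /= jj _ _; congr (h i _); apply: (c_inj i); rewrite ca ca' jj.
- move=> j; have jm : lift ord_max j != ord_max by rewrite eq_sym neq_lift.
  have [<- <-] := cP _ jm; split; last exact: sumE.
  have := sumE R^o (fun=> 1) j.
  under eq_bigr do rewrite [_ *: _]mulr1.
  by move=> ->; apply: eq_bigr => i _; apply: eq_bigr => a _; rewrite [_ *: _]mulr1.
Qed.

(** * Gale duality and fans *)

(** The row space of [A] consists of the values of affine functions at the points; by spanning it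
    has dimension [m + 1]. A column basis of [cokermx A] has [d] columns and the row space of [A] as
    left kernel; its rows are the vectors [G i]. *)
Lemma gale_dual (K : fieldType) (n m d : nat) (x : 'I_n -> 'rV[K]_m) :
    (n = m + 1 + d)%N ->
    (forall a b, (forall i, dotv a (x i) = b) -> a = 0) ->
  exists G : 'I_n -> 'rV[K]_d, forall f : 'I_n -> K,
    \sum_i f i *: G i = 0 -> exists a b, forall i, f i = dotv a (x i) - b.
Proof.
move=> nE xs; pose A : 'M[K]_(m + 1, n) := col_mx (\matrix_(l, i) x i 0 l) (const_mx 1).
have AE (a : 'rV[K]_m) (c : 'rV[K]_1) i : (row_mx a c *m A) 0 i = dotv a (x i) + c 0 0.
  rewrite mul_row_col mxE; congr (_ + _).
    by rewrite mxE; apply: eq_bigr => l _; rewrite mxE.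
  by rewrite mxE big_ord1 mxE mulr1.
have A_free : row_free A.
  apply: inj_row_free => v; rewrite -[v]hsubmxK => vA0.
  have v0 i : dotv (lsubmx v) (x i) + rsubmx v 0 0 = 0 by rewrite -AE vA0 mxE.
  have l0 : lsubmx v = 0.
    by apply: (xs _ (- rsubmx v 0 0)) => i; apply/eqP; rewrite -addr_eq0 v0.
  rewrite l0; suff -> : rsubmx v = 0 by rewrite row_mx0.
  have n0 : (0 < n)%N by rewrite nE addn1.
  apply/rowP => j; rewrite !mxE !ord1; have := v0 (Ordinal n0).
  by rewrite l0 /dotv big1 ?add0r ?mxE // => l _; rewrite mxE mul0r.
have [B BP] : exists B : 'M[K]_(n, d), forall f : 'rV_n, f *m B = 0 -> f *m cokermx A = 0.
  have rC : \rank (cokermx A) = d.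
    by rewrite mxrank_coker (eqP A_free) nE addnC addnK.
  rewrite -rC; exists (col_base (cokermx A)) => f f0.
  by rewrite -[X in f *m X]mulmx_base mulmxA f0 mul0mx.
exists (fun i => row i B) => f f0.
have : (\row_i f i <= A)%MS.
  rewrite submxE BP // mulmx_sum_row -[RHS]f0.
  by apply: eq_bigr => i _; rewrite mxE.
case/submxP => v vA; exists (lsubmx v), (- rsubmx v 0 0) => i.
by rewrite opprK -AE hsubmxK -vA mxE.
Qed.

Lemma enumerate_coloring (V : choiceType) (n c r : nat) (X : {fset V})
    (Xs : 'I_c -> {fset V}) :
    #|` X| = n -> coloring Xs X -> (forall k, r <= #|` Xs k|)%N ->
  exists (x : 'I_n -> V) (col : 'I_n -> 'I_c),
    [/\ forall v, v \in X -> exists i, v = x i,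
        forall i, x i \in X,
        forall i k, x i \in Xs k -> col i = k &
        forall k, (r <= #|[pred i | col i == k]|)%N].
Proof.
move=> <- [Xcover Xtriv _] Xr.
pose x (i : 'I_#|` X|) := tnth (in_tuple X) i.
have xX i : x i \in X by exact: mem_tnth.
have Xx v : v \in X -> exists i, v = x i by move=> /(@tnthP _ _ (in_tuple X)).
have [col colP] : exists col : 'I_#|` X| -> 'I_c, forall i, x i \in Xs (col i).
  apply: (fin_all_exists (P := fun i k => x i \in Xs k)) => i.
  have : [set` X] (x i) := xX i.
  by rewrite -Xcover => -[k _ xk]; exists k.
have colE i k : x i \in Xs k -> col i = k.
  by move=> xk; apply: (Xtriv _ _ I I); exists (x i); split => //; exact: colP.
exists x, col; split => // k.
apply: leq_trans (Xr k) _; rewrite -(size_image x); apply: uniq_leq_size => [|v vk].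
  exact: fset_uniq.
have vX : v \in X.
  by suff : [set` X] v by []; rewrite -Xcover; exists k.
by have [i vi] := Xx v vX; rewrite vi; apply: fintype.image_f; rewrite inE; apply/eqP/colE; rewrite -vi.
Qed.

(** * Cyclic indices and conical fans *)

Lemma val_ordS r (j : 'I_r) : val (ordS j) = if j.+1 == r then 0%N else j.+1.
Proof.
rewrite /=; case: eqP => [->|/eqP jr]; first exact: modnn.
by rewrite modn_small // ltn_neqAle jr ltn_ord.
Qed.

Lemma ordS_neq r (j : 'I_r) : (1 < r)%N -> ordS j != j.
Proof. by move=> r1; rewrite -val_eqE val_ordS /=; case: ifP => [/eqP|_]; lia. Qed.

Lemma ordS2_neq r (j : 'I_r) : (2 < r)%N -> ordS (ordS j) != j.
Proof.
move=> r2; rewrite -val_eqE val_ordS val_ordS /=.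
by case: (j.+1 =P r) => e; case: ifP => [/eqP|_]; lia.
Qed.

Lemma ordS_invariant_cst (T : Type) r (f : 'I_r -> T) :
  (forall j, f (ordS j) = f j) -> forall j j', f j = f j'.
Proof.
case: r f => [|r] f fS; first by case.
suff H j : f j = f ord0 by move=> j j'; rewrite !H.
case: j => m; elim: m => [|m IH] mr; first by congr f; apply: val_inj.
rewrite -(IH (ltnW mr)) -[RHS]fS; congr f; apply: val_inj.
by rewrite /= modn_small.
Qed.

Lemma conical_fan_of_points (R : realType) (d r n m : nat)
    (x : 'I_n -> 'rV[R]_m) (col : 'I_n -> 'I_(d + 1)) :
    (n = m + 1 + d)%N -> (2 < r)%N -> prime r.+1 ->
    (forall a b, (forall i, dotv a (x i) = b) -> a = 0) ->
    (forall k, (r <= #|[pred i | col i == k]|)%N) ->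
  exists (B : 'I_r -> set 'rV[R]_m) (C : set 'rV[R]_m),
    [/\ conical_fan B C, forall i, exists j, B j (x i) &
        forall j i i', col i = col i' -> (B j `\` C) (x i) -> (B j `\` C) (x i') ->
          i = i'].
Proof.
move=> nE r2 r1_prime xs col_r.
have r1 : (1 < r)%N by exact: ltnW.
have [G GP] := gale_dual nE xs.
have [cls [T [s [b [T0 s0 rainbow sumT]]]]] := rainbow_tverberg G r1_prime r1 (addn1 d) col_r.
pose f (j : 'I_r) i := (cls i == j)%:R * T i - (cls i == ordS j)%:R * T i.
have sumf j : \sum_i (cls i == j)%:R * T i *: G i = b.
  rewrite -(sumT j).2 [RHS]big_mkcond; apply: eq_bigr => i _.
  by case: eqP; rewrite ?mul1r // mul0r scale0r.
have [a [be fE]] : exists (a : 'I_r -> 'rV[R]_m) (be : 'I_r -> R),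
    forall j i, f j i = dotv (a j) (x i) - be j.
  have H j : exists p : 'rV[R]_m * R, forall i, f j i = dotv p.1 (x i) - p.2.
    have [|u [v uv]] := GP (f j); last by exists (u, v).
    by under eq_bigr do rewrite scalerBl; rewrite sumrB !sumf subrr.
  have [p pP] := fin_all_exists H.
  by exists (fun j => (p j).1), (fun j => (p j).2).
have dotv_sum (la : 'I_r -> R) z : dotv (\sum_j la j *: a j) z = \sum_j la j * dotv (a j) z.
  rewrite /dotv; under [RHS]eq_bigr do rewrite mulr_sumr.
  rewrite [RHS]exchange_big; apply: eq_bigr => l _ /=; rewrite summxE mulr_suml.
  by apply: eq_bigr => j _; rewrite mxE mulrA.
have dot0 z : dotv 0 z = 0 :> R by rewrite /dotv big1 // => l _; rewrite mxE mul0r.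
(* Summation by parts: point [i] occurs only in [f (cls i)] and [f (ord_pred (cls i))], with
   opposite signs. *)
have comb (la : 'I_r -> R) i : \sum_j la j * f j i = (la (cls i) - la (ord_pred (cls i))) * T i.
  under eq_bigr do rewrite mulrBr; rewrite sumrB (bigD1 (cls i)) //= eqxx mul1r.
  rewrite big1 ?addr0 => [|j /negPf jc]; last by rewrite eq_sym jc mul0r mulr0.
  rewrite (bigD1 (ord_pred (cls i))) //= ord_predK eqxx mul1r.
  rewrite big1 ?addr0 ?mulrBl // => j jc; rewrite (_ : cls i == ordS j = false) ?mul0r ?mulr0 //.
  by apply: contraNF jc => /eqP ->; rewrite ordSK.
have positive j : exists2 i, cls i = j & 0 < T i.
  apply: contrapT => none; have := s0; rewrite -(sumT j).1 big1 ?ltxx // => i /eqP ij.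
  by apply/eqP; rewrite eq_le T0 andbT leNgt; apply/negP => Ti; apply: none; exists i.
(* A relation between the normals makes the same combination of the [f j] a constant [K]. Once
   [K = 0], a positive weight in every class forces equal coefficients. *)
have comb_const (la : 'I_r -> R) : \sum_j la j *: a j = 0 -> forall j j', la j = la j'.
  move=> la0; pose K := - \sum_j la j * be j.
  have KE i : (la (cls i) - la (ord_pred (cls i))) * T i = K.
    rewrite -comb; under eq_bigr do rewrite fE mulrBr.
    by rewrite sumrB -dotv_sum la0 dot0 sub0r.
  have [w wc wT] := fin_all_exists2 positive.
  have laE j : la j - la (ord_pred j) = K * (T (w j))^-1.
    by rewrite -(KE (w j)) wc mulfK // gt_eqF.
  (* [K] is proportional to the telescoping sum of the [la j - la (ord_pred j)]. *)
  have K0 : K = 0.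
    have : K * \sum_j (T (w j))^-1 = 0.
      rewrite mulr_sumr; under eq_bigr do rewrite -laE.
      rewrite sumrB [X in _ - X](reindex_inj (@ordS_inj r)) /=.
      by under [X in _ - X]eq_bigr do rewrite ordSK; rewrite subrr.
    move/eqP; rewrite mulf_eq0 => /orP[/eqP //|]; rewrite gt_eqF //.
    rewrite (bigD1 (Ordinal (ltnW r1))) //= ltr_pwDl ?invr_gt0 //; last first.
      by apply: sumr_ge0 => j _; rewrite invr_ge0.
  apply: ordS_invariant_cst => j; apply/eqP; rewrite -subr_eq0.
  by rewrite -{2}(ordSK j) laE K0 mul0r.
pose N : 'M[R]_(r, m) := \matrix_j a j.
have NE j : row j N = a j by rewrite rowK.
have free j0 : row_free (row' j0 N).
  apply: inj_row_free => v v0.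
  pose la j := if unlift j0 j is Some l then v 0 l else 0.
  have la0 : \sum_j la j *: a j = 0.
    rewrite -[RHS]v0 mulmx_sum_row (bigD1 j0) //= {1}/la unlift_none scale0r add0r.
    rewrite (reindex_omap (lift j0) (unlift j0)) /=; last first.
      by move=> j; case: unliftP => [l ->|->] //; rewrite eqxx.
    apply: eq_big => [l|l _]; first by rewrite liftK eqxx eq_sym neq_lift.
    by rewrite /la liftK row_rowsub NE.
  apply/rowP => l; have := comb_const la la0 (lift j0 l) j0.
  by rewrite /la liftK unlift_none mxE.
(* The [f j] cancel at every point, so by spanning their sum has zero linear part. *)
have suma0 : \sum_j a j = 0.
  apply: (xs _ (\sum_j be j)) => i; rewrite -[X in dotv X](eq_bigr _ (fun j _ => scale1r (a j))).
  rewrite dotv_sum; apply/eqP; rewrite -subr_eq0 -sumrB.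
  under eq_bigr do rewrite mul1r -fE -[f _ _]mul1r.
  by rewrite comb subrr mul0r.
have sumbe0 : \sum_j be j = 0.
  have [i _ _] := positive (Ordinal (ltnW r1)).
  have := comb (fun=> 1) i; rewrite subrr mul0r.
  under eq_bigr do rewrite mul1r fE -[dotv _ _]mul1r.
  rewrite sumrB -dotv_sum; under eq_bigr do rewrite scale1r.
  by rewrite suma0 dot0 sub0r => /eqP; rewrite oppr_eq0 => /eqP.
pose H j := hyperplane (row j N) (be j).
have HE j i : H j (x i) <-> f j i = 0.
  rewrite /H /hyperplane /= NE fE; split => [->|/eqP]; first by rewrite subrr.
  by rewrite subr_eq0 => /eqP.
exists (fun j => halfspace (row j N) (be j) `&`
                 \bigcap_(i in [set i | i != ord_pred j /\ i != j]) H i), (\bigcap_j H j).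
split.
- exists N, be; split => //; split.
    apply/negP => /row_freeP[N' NN'].
    have N1 : (const_mx 1 : 'rV[R]_r) *m N = 0.
      rewrite mulmx_sum_row -[RHS]suma0; apply: eq_bigr => j _.
      by rewrite NE mxE scale1r.
    have : (const_mx 1 : 'rV[R]_r) = 0 by rewrite -[LHS]mulmx1 -NN' mulmxA N1 mul0mx.
    by move=> /rowP/(_ (Ordinal (ltnW r1))); rewrite !mxE => /eqP; rewrite oner_eq0.
  (* Independence gives a point on all hyperplanes but that of [j0]; it lies on this one too,
     because the [a j] and the [be j] both sum to [0]. *)
  pose j0 : 'I_r := Ordinal (ltnW r1).
  have /row_freeP[N' NN'] := free j0.
  pose z := (N' *m \col_l be (lift j0 l))^T.
  have zl l : dotv (a (lift j0 l)) z = be (lift j0 l).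
    have /colP/(_ l) : row' j0 N *m z^T = \col_l be (lift j0 l).
      by rewrite trmxK mulmxA NN' mul1mx.
    by rewrite !mxE => <-; apply: eq_bigr => h _; rewrite !mxE.
  have zj j : j != j0 -> dotv (a j) z = be j.
    by case: (unliftP j0 j) => [l -> _|->]; rewrite ?zl ?eqxx.
  exists z => j _; rewrite /hyperplane /= NE.
  case: (eqVneq j j0) => [->|]; last exact: zj.
  have := dotv_sum (fun=> 1) z; rewrite (eq_bigr _ (fun j _ => scale1r (a j))).
  rewrite suma0 dot0 (bigD1 j0) //= mul1r.
  under eq_bigr => j' jj' do rewrite mul1r (zj _ jj').
  move=> /esym/eqP; rewrite addr_eq0 => /eqP ->.
  by move: sumbe0; rewrite (bigD1 j0) //= => /eqP; rewrite addr_eq0 => /eqP ->.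
- move=> i; exists (cls i); split.
    rewrite /halfspace /= NE -subr_ge0 -fE /f eqxx mul1r eq_sym (negPf (ordS_neq _ r1)).
    by rewrite mul0r subr0.
  move=> j [/eqP jp /eqP jc]; apply/HE.
  have -> : f j i = (cls i == j)%:R * T i - (cls i == ordS j)%:R * T i by [].
  have -> : cls i == j = false by apply/eqP => e; apply: jc.
  have -> : cls i == ordS j = false by apply/eqP => e; apply: jp; rewrite e ordSK.
  by rewrite mul0r subrr.
(* Off the center [T i != 0], and [x i] misses exactly the hyperplanes of index [cls i] and
   [ord_pred (cls i)]. Both indices are then among [ord_pred j] and [j], which for [2 < r] forces
   [cls i = j]. *)
- have clsE j i : ((halfspace (row j N) (be j) `&`
      \bigcap_(i in [set i | i != ord_pred j /\ i != j]) H i) `\` \bigcap_j H j) (x i) ->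
      cls i = j /\ T i != 0.
    move=> [[_ Bi] Ci].
    have Ti : T i != 0.
      by apply/eqP => Ti; apply: Ci => l _; apply/HE; rewrite /f Ti !mulr0 subrr.
    split=> //; apply/eqP; apply: contraT => cj.
    have c1 : cls i = ord_pred j.
      apply/eqP; apply: contraT => cp; have /HE := Bi (cls i) (conj cp cj).
      rewrite /f eqxx eq_sym (negPf (ordS_neq _ r1)) mul0r subr0 mul1r => /eqP.
      by rewrite (negPf Ti).
    have pp : ord_pred (cls i) != ord_pred j.
      rewrite -c1 -(inj_eq (@ordS_inj r)) ord_predK eq_sym; exact: ordS_neq.
    have pj : ord_pred (cls i) != j.
      by rewrite c1 -(inj_eq (@ordS_inj r)) ord_predK -(inj_eq (@ordS_inj r)) ord_predK
        eq_sym ordS2_neq.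
    have /HE := Bi _ (conj pp pj).
    rewrite /f ord_predK eqxx -{1}(ord_predK (cls i)) (negPf (ordS_neq _ r1)).
    by rewrite mul0r mul1r sub0r => /eqP; rewrite oppr_eq0 (negPf Ti).
  by move=> j i i' ii' /clsE[ci Ti] /clsE[ci' Ti']; apply: rainbow => //; rewrite ci ci'.
Qed.

(** * Roots of unity *)

Section RootsOfUnity.
Variable R : realType.
Local Open Scope complex_scope.

Definition cis (x : R) : R[i] := Complex (cos x) (sin x).

Lemma cisD x y : cis (x + y) = cis x * cis y.
Proof. by apply/eqP; rewrite eq_complex /= cosD sinD [X in _ && (X == _)]addrC !eqxx. Qed.

Lemma cos_neq1 (x : R) : 0 < x < 2 * pi -> cos x != 1.
Proof.
move=> /andP[x0 x2]; suff H y : 0 < y <= pi -> cos y != 1 :> R.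
  case: (leP x pi) => xpi; first by apply: H; rewrite x0.
  have -> : cos x = cos (pi *+ 2 - x).
    by rewrite addrC cosD2pi cosN.
  by apply: H; rewrite mulr2n; lra.
move=> /andP[y0 ypi]; apply/eqP => cy.
have := @cosK R y; rewrite in_itv /= (ltW y0) ypi cy acos1 => /(_ isT) y0'.
by rewrite y0' ltxx in y0.
Qed.

Variable r : nat.
Hypothesis r_gt1 : (1 < r)%N.

Definition unity (j : nat) : R[i] := cis (2 * pi / r%:R * j%:R).

Lemma unityD j j' : unity (j + j') = unity j * unity j'.
Proof. by rewrite /unity natrD mulrDr cisD. Qed.

Lemma r_neq0 : r%:R != 0 :> R.
Proof. by rewrite pnatr_eq0 -lt0n ltnW. Qed.

Lemma unity_period : unity r = 1.
Proof.
rewrite /unity divfK ?r_neq0 // /cis mulrC -[2]/(1 + 1) mulrDr mulr1 -mulr2n.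
by rewrite cos2pi sin2pi.
Qed.

Lemma unity_ordS (j : 'I_r) : unity (ordS j) = unity j * unity 1.
Proof.
rewrite -unityD addn1 val_ordS; case: eqP => // ->; rewrite unity_period.
by rewrite /unity mulr0 /cis cos0 sin0.
Qed.

Lemma unity_conj j : (unity j)^* * unity j = 1.
Proof.
apply/eqP; rewrite eq_complex /= mulNr opprK -!expr2 cos2Dsin2 eqxx /=.
by rewrite mulNr mulrC subrr.
Qed.

Lemma unity_neq0 j : unity j != 0.
Proof. by apply/eqP => u0; have /eqP := unity_conj j; rewrite u0 mulr0 eq_sym oner_eq0. Qed.

Lemma unity_neq1 j : (0 < j < r)%N -> unity j != 1.
Proof.
move=> /andP[j0 jr]; rewrite eq_complex /= negb_and cos_neq1 //.
rewrite mulr_gt0 ?divr_gt0 ?mulr_gt0 ?pi_gt0 ?ltr0n ?(ltnW r_gt1) //=.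
rewrite mulrAC ltr_pdivrMr ?ltr0n ?(ltnW r_gt1) // ltr_pM2l ?ltr_nat //.
by rewrite mulr_gt0 ?pi_gt0.
Qed.

Lemma unity_inj (j j' : 'I_r) : unity j = unity j' -> j = j'.
Proof.
wlog jj' : j j' / (j <= j')%N.
  by move=> H e; case/orP: (leq_total j j') => /H; [apply|move/(_ (esym e))].
rewrite -(subnKC jj') unityD -{1}[unity j]mulr1 => /(mulfI (unity_neq0 j)) /esym/eqP e.
apply/val_inj/eqP; rewrite eqn_leq jj' leqNgt; apply/negP => lt_jj'.
by move: e; rewrite (negPf (unity_neq1 _)) // subn_gt0 lt_jj' (leq_ltn_trans (leq_subr _ _)) .
Qed.

(** Comparing squared moduli gives [t = t'], which cancels. *)
Lemma unity_ray_inj (j j' : 'I_r) (t t' : R) :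
  0 < t -> 0 <= t' -> t%:C * unity j = t'%:C * unity j' -> j = j'.
Proof.
move=> t0 t'0 e.
have tt : t ^+ 2 = t' ^+ 2.
  apply: complexI; rewrite !rmorphXn /= !expr2.
  have N (s : R) i : s%:C * s%:C = (s%:C * unity i)^* * (s%:C * unity i).
    rewrite (rmorphM conjc) mulrACA unity_conj mulr1; congr (_ * _).
    by apply/eqP; rewrite eq_complex /= oppr0 !eqxx.
  by rewrite (N t j) (N t' j') e.
have tE : t = t' by apply/eqP; rewrite -(eqrXn2 (n := 2)) ?tt // ltW.
have tC : t%:C != 0 by rewrite -[0]/(0%:C) (inj_eq (@complexI R)) gt_eqF.
by apply: unity_inj; apply: (mulfI tC); rewrite e tE.
Qed.

(** Multiplication by [unity 1 != 1] permutes the terms. *)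
Lemma sum_unity : \sum_(j < r) unity j = 0.
Proof.
apply/eqP; have u1 : unity 1 - 1 != 0 by rewrite subr_eq0 unity_neq1.
rewrite -(mulrI_eq0 _ (mulfI u1)) mulrBl mul1r mulr_sumr.
have -> : \sum_(j < r) unity 1 * unity j = \sum_(j < r) unity j.
  rewrite [RHS](reindex_inj (@ordS_inj r)); apply: eq_bigr => j _.
  by rewrite unity_ordS mulrC.
by rewrite subrr.
Qed.

End RootsOfUnity.

(** * Real coordinates and dot products *)

Section Realify.
Variables (R : realType) (m : nat).
Local Open Scope complex_scope.
Implicit Types z : 'rV[R[i]]_m.

Lemma realifyD z z' : realify (z + z') = realify z + realify z'.
Proof.
rewrite /realify add_row_mx; congr row_mx; apply/rowP => l; rewrite !mxE;
by case: (z 0 l); case: (z' 0 l).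
Qed.

Lemma realifyZ (t : R) z : realify (t%:C *: z) = t *: realify z.
Proof.
rewrite /realify scale_row_mx; congr row_mx; apply/rowP => l; rewrite !mxE;
by case: (z 0 l) => a b /=; rewrite mul0r ?subr0 ?addr0.
Qed.

Lemma realify_inj : injective (@realify R m).
Proof.
move=> z z' /eq_row_mx[/rowP re /rowP im]; apply/rowP => l.
have := re l; have := im l; rewrite !mxE; case: (z 0 l) => a b; case: (z' 0 l) => a' b' /=.
by move=> -> ->.
Qed.

Lemma realify_surj (X : 'rV[R]_(m + m)) : exists z, realify z = X.
Proof.
exists (\row_l (lsubmx X 0 l +i* rsubmx X 0 l)); rewrite -[RHS]hsubmxK.
by congr row_mx; apply/rowP => l; rewrite mxE [in LHS]mxE.
Qed.

(** As [dotv] is bilinear, the vector representing this real linear form involves the conjugate of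
    [a]. *)
Lemma dotv_realify (a : 'rV[R[i]]_m) (c : R[i]) z :
  dotv (realify (c *: map_mx conjc a)) (realify z) = complex.Re (c^* * dotv a z).
Proof.
have ReD (x y : R[i]) : complex.Re (x + y) = complex.Re x + complex.Re y by case: x; case: y.
rewrite /dotv big_split_ord /= -big_split /= mulr_sumr (big_morph _ ReD (erefl _)).
apply: eq_bigr => l _; rewrite !row_mxEl !row_mxEr !mxE.
by case: c => c1 c2; case: (a 0 l) => a1 a2; case: (z 0 l) => z1 z2 /=; ring.
Qed.

End Realify.

Lemma dotvE (F : fieldType) m (a x : 'rV[F]_m) : dotv a x = (a *m x^T) 0 0.
Proof. by rewrite mxE; apply: eq_bigr => l _; rewrite mxE. Qed.

Lemma dotvC (F : fieldType) m (a x : 'rV[F]_m) : dotv a x = dotv x a.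
Proof. by apply: eq_bigr => l _; rewrite mulrC. Qed.

Lemma dotvDr (F : fieldType) m (a x y : 'rV[F]_m) : dotv a (x + y) = dotv a x + dotv a y.
Proof. by rewrite !dotvE linearD mulmxDr mxE. Qed.

Lemma dotvZr (F : fieldType) m c (a x : 'rV[F]_m) : dotv a (c *: x) = c * dotv a x.
Proof. by rewrite !dotvE linearZ -scalemxAr mxE. Qed.

Lemma dotvBr (F : fieldType) m (a x y : 'rV[F]_m) : dotv a (x - y) = dotv a x - dotv a y.
Proof. by rewrite dotvDr -scaleN1r dotvZr mulN1r. Qed.

Lemma dotvZl (F : fieldType) m c (a x : 'rV[F]_m) : dotv (c *: a) x = c * dotv a x.
Proof. by rewrite dotvC dotvZr dotvC. Qed.

Lemma hyperplane_flat (F : fieldType) m (n p : 'rV[F]_m) : n != 0 ->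
  is_flat m.-1 (hyperplane n (dotv n p)).
Proof.
move=> n0; exists p, (kermx n^T); split.
  by rewrite mxrank_ker mxrank_tr rank_rV n0 subn1.
apply/seteqP; split => x; rewrite /hyperplane /= => h.
  by apply/sub_kermxP/rowP => i; rewrite (ord1 i) [RHS]mxE -dotvE dotvC dotvBr h subrr.
move/sub_kermxP: h => /matrixP/(_ 0 0); rewrite -dotvE [RHS]mxE dotvC dotvBr.
by move/eqP; rewrite subr_eq0 => /eqP.
Qed.

(** * Half-hyperplanes with normal [v] and inward direction [u] *)

Section NormalFrame.
Variables (R : realType) (m : nat) (u v p : 'rV[R]_m).
Hypothesis uu : dotv u u = 1.
Hypothesis vu : dotv v u = 0.

Definition frame_half : set 'rV[R]_m :=
  [set x | dotv u p <= dotv u x /\ dotv v x = dotv v p].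

Definition frame_center : set 'rV[R]_m :=
  [set x | dotv u x = dotv u p /\ dotv v x = dotv v p].

Lemma frame_half_flat : (1 < m)%N -> v != 0 -> half_flat m.-1 frame_half frame_center.
Proof.
move=> m1 v0; exists (hyperplane v (dotv v p)), u, (dotv u p); split.
  split; [by lia|exact: hyperplane_flat|].
  apply/eqP => u0; have /eqP := uu; rewrite {1}u0 /dotv big1 => [|l _].
    by rewrite eq_sym oner_eq0.
  by rewrite mxE mul0r.
split.
- by exists p.
- move=> /(_ (p + u)); rewrite /hyperplane /= !dotvDr vu addr0 uu => /(_ erefl) /eqP.
  by rewrite -subr_eq0 addrAC subrr add0r oner_eq0.
- by apply/seteqP; split => x [].
- by apply/seteqP; split => x [].
Qed.

Lemma frame_inner_normal : inner_normal frame_center frame_half u.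
Proof.
split=> //; first by move=> x y [xu _] [yu _]; rewrite dotvBr xu yu subrr.
apply/seteqP; split => [x [xu xv]|_ [c [t [[cu cv] t0 ->]]]].
  exists (x - (dotv u x - dotv u p) *: u), (dotv u x - dotv u p).
  split; rewrite ?subr_ge0 ?subrK //; split; rewrite dotvBr dotvZr ?uu ?vu.
    by rewrite mulr1 opprB addrC subrK.
  by rewrite mulr0 subr0.
split; rewrite dotvDr dotvZr ?uu ?vu ?mulr1 ?mulr0 ?addr0 //.
by rewrite cu lerDl.
Qed.

End NormalFrame.

(** * The complex regular fan of a unit vector *)

Section UnitFan.
Variables (R : realType) (m r : nat).
Local Open Scope complex_scope.
Variables (a : 'rV[R[i]]_m) (be : R[i]).
Hypothesis a_unit : dotv a (map_mx conjc a) = 1.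
Hypothesis m_gt0 : (0 < m)%N.
Hypothesis r_gt1 : (1 < r)%N.
Local Notation om := (unity R r).
Local Notation Re := (@complex.Re R).
Local Notation Im := (@complex.Im R).

Definition ray_set (j : nat) : set 'rV[R[i]]_m :=
  [set z | exists t : R, 0 <= t /\ dotv a z = be + t%:C * om j].

(** Adding [dir c] to a vector adds [c] to its value under [dotv a]. Hence [u j] points along the
    ray of index [j], and its quarter turn [v j] is normal to the half-hyperplane. *)
Let dir (c : R[i]) := c *: map_mx conjc a.
Let u (j : nat) := realify (dir (om j)).
Let v (j : nat) := realify (dir ('i * om j)).

Let dotv_dir c : dotv a (dir c) = c.
Proof. by rewrite dotvZr a_unit mulr1. Qed.

Let dotv_u j z : dotv (u j) (realify z) = Re ((om j)^* * dotv a z).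
Proof. exact: dotv_realify. Qed.

Let dotv_u_dir j c : dotv (u j) (realify (dir c)) = Re ((om j)^* * c).
Proof. by rewrite dotv_realify dotv_dir. Qed.

Let dotv_uu j : dotv (u j) (u j) = 1.
Proof. by rewrite dotv_u_dir unity_conj. Qed.

Let dotv_vu j : dotv (v j) (u j) = 0.
Proof.
rewrite dotv_realify dotv_dir rmorphM -mulrA unity_conj mulr1 /=.
by [].
Qed.

Let unityK j w : om j * ((om j)^* * w) = w.
Proof. by rewrite mulrCA mulrA unity_conj mul1r. Qed.

Let eq_Re_Im (w w' : R[i]) : Re w = Re w' -> Im w = Im w' -> w = w'.
Proof. by case: w w' => x y [x' y'] /= -> ->. Qed.

Let dotv_v j z : dotv (v j) (realify z) = Im ((om j)^* * dotv a z).
Proof.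
rewrite dotv_realify rmorphM -mulrA; case: (_ * dotv a z) => x y /=.
by rewrite mul0r sub0r mulN1r opprK.
Qed.

Let C0 := realify (dir be).

Let dotv_uC j : dotv (u j) C0 = Re ((om j)^* * be).
Proof. exact: etrans (dotv_u j (dir be)) (congr1 (fun w => Re ((om j)^* * w)) (dotv_dir be)). Qed.

Let dotv_vC j : dotv (v j) C0 = Im ((om j)^* * be).
Proof. exact: etrans (dotv_v j (dir be)) (congr1 (fun w => Im ((om j)^* * w)) (dotv_dir be)). Qed.

(** Multiplication by the conjugate of [om j] turns the ray into a horizontal one. *)
Let ray_Re_Im j (w : R[i]) : (exists t : R, 0 <= t /\ w = be + t%:C * om j) <->
  Re ((om j)^* * be) <= Re ((om j)^* * w) /\ Im ((om j)^* * w) = Im ((om j)^* * be).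
Proof.
split => [[t [t0 ->]]|[re im]].
  rewrite mulrDr mulrCA unity_conj mulr1; case: (_ * be) => x y /=.
  by rewrite addr0 lerDl.
exists (Re ((om j)^* * w) - Re ((om j)^* * be)); split; first by rewrite subr_ge0.
have E : (om j)^* * w = (om j)^* * be + (Re ((om j)^* * w) - Re ((om j)^* * be))%:C.
  apply: eq_Re_Im; first by case: ((om j)^* * be) => x y /=; rewrite addrC subrK.
  by rewrite im; case: ((om j)^* * be) => x y /=; rewrite addr0.
by rewrite -[LHS](unityK j) {1}E mulrDr unityK [om j * _]mulrC.
Qed.

Let center_Re_Im j (w : R[i]) : w = be <->
  Re ((om j)^* * w) = Re ((om j)^* * be) /\ Im ((om j)^* * w) = Im ((om j)^* * be).
Proof.
split=> [->//|[re im]].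
by rewrite -[LHS](unityK j) (eq_Re_Im re im) unityK.
Qed.

Let ray_uv j z : ray_set j z <->
  dotv (u j) C0 <= dotv (u j) (realify z) /\ dotv (v j) (realify z) = dotv (v j) C0.
Proof.
have := ray_Re_Im j (dotv a z).
by case: _ / (dotv_u j z); case: _ / (dotv_v j z); case: _ / (dotv_uC j); case: _ / (dotv_vC j).
Qed.

Let C_uv j z : hyperplane a be z <->
  dotv (u j) (realify z) = dotv (u j) C0 /\ dotv (v j) (realify z) = dotv (v j) C0.
Proof.
have := center_Re_Im j (dotv a z).
by case: _ / (dotv_u j z); case: _ / (dotv_v j z); case: _ / (dotv_uC j); case: _ / (dotv_vC j).
Qed.

Let ray_frame j : @realify R m @` ray_set j = frame_half (u j) (v j) C0.
Proof.
apply/seteqP; split => [_ [z /ray_uv zj <-] //|X].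
by have [z <-] := realify_surj X => zj; exists z => //; apply/ray_uv.
Qed.

Let center_frame j : @realify R m @` hyperplane a be = frame_center (u j) (v j) C0.
Proof.
apply/seteqP; split => [_ [z /(C_uv j) zj <-] //|X].
by have [z <-] := realify_surj X => zj; exists z => //; apply/(C_uv j).
Qed.

Let dotv_vv j : dotv (v j) (v j) = 1.
Proof.
have := dotv_v j (dir ('i * om j)); rewrite (dotv_dir ('i * om j)) mulrCA unity_conj mulr1.
by [].
Qed.

Let v_neq0 j : v j != 0.
Proof.
apply/eqP => v0; have /eqP := dotv_vv j; rewrite {1}v0 /dotv big1 => [|l _].
  by rewrite eq_sym oner_eq0.
by rewrite mxE mul0r.
Qed.

Let ray_half_flat j :
  half_flat (m + m).-1 (@realify R m @` ray_set j) (@realify R m @` hyperplane a be).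
Proof.
have m1 : (1 < m + m)%N by lia.
have := frame_half_flat C0 (dotv_uu j) (dotv_vu j) m1 (v_neq0 j).
by case: _ / (ray_frame j); case: _ / (center_frame j).
Qed.

Let ray_inner_normal j :
  inner_normal (@realify R m @` hyperplane a be) (@realify R m @` ray_set j) (u j).
Proof.
have := frame_inner_normal C0 (dotv_uu j) (dotv_vu j).
by case: _ / (ray_frame j); case: _ / (center_frame j).
Qed.

Lemma unit_complex_regular_fan :
  complex_regular_fan (fun j : 'I_r => ray_set j) (hyperplane a be).
Proof.
split; last first.
  exists a, be; split => //; apply/eqP => a0; move: a_unit; rewrite a0 /dotv big1.
    by move/eqP; rewrite eq_sym oner_eq0.
  by move=> l _; rewrite mxE mul0r.
split; first split.
- move=> j j' /seteqP[sub _].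
  have : (@realify R m @` ray_set j) (realify (dir be + dir (om j))).
    exists (dir be + dir (om j)) => //; exists 1; split => //.
    by rewrite dotvDr !dotv_dir mul1r.
  move=> /sub[z [t [t0 zt]] /realify_inj zE].
  apply: (unity_ray_inj r_gt1 (@ltr01 R) t0).
  apply: (addrI be); rewrite -zt zE dotvDr !dotv_dir mul1r.
  by [].
- exact: ray_half_flat.
- move=> j; exists (u j), (u (ordS j)); split; [exact: ray_inner_normal|exact: ray_inner_normal|].
  (* The product is the real part of [om 1], that is [cos (2 * pi / r%:R)], and the angle is at most
     [pi] because [2 <= r]. *)
  rewrite dotv_u_dir unity_ordS // mulrA unity_conj mul1r /= mulr1 cosK // in_itv /=.
  rewrite divr_ge0 ?mulr_ge0 ?pi_ge0 //= ler_pdivrMr ?ltr0n ?(ltnW r_gt1) //.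
  by rewrite mulrC ler_pM2l ?pi_gt0 // ler_nat.
Qed.

End UnitFan.

(** * The complex regular fan of a point set *)

Lemma dotv_conj_gt0 (R : realType) m (a : 'rV[R[i]]_m) : a != 0 ->
  exists2 nu : R, 0 < nu & dotv a (map_mx conjc a) = (nu%:C)%C.
Proof.
move=> a0; exists (\sum_l (complex.Re (a 0 l) ^+ 2 + complex.Im (a 0 l) ^+ 2)); last first.
  rewrite rmorph_sum; apply: eq_bigr => l _; rewrite mxE.
  case: (a 0 l) => x y; apply/eqP; rewrite eq_complex /=.
  by apply/andP; split; apply/eqP; ring.
have ge0 l : 0 <= complex.Re (a 0 l) ^+ 2 + complex.Im (a 0 l) ^+ 2.
  by rewrite addr_ge0 ?sqr_ge0.
rewrite lt_def sumr_ge0 // andbT; apply: contra a0 => /eqP.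
rewrite /= => /eqP; rewrite psumr_eq0 // => /allP h; apply/eqP/rowP => l; rewrite mxE.
have := h l (mem_index_enum _); rewrite /= paddr_eq0 ?sqr_ge0 // !sqrf_eq0.
by case: (a 0 l) => x y /= /andP[/eqP -> /eqP ->].
Qed.

Lemma realify_sum (R : realType) m (I : finType) (Q : pred I) (F : I -> 'rV[R[i]]_m) :
  realify (\sum_(i | Q i) F i) = \sum_(i | Q i) realify (F i).
Proof.
apply: (big_morph _ (@realifyD R m)).
by have := @realifyZ R m 0 0; rewrite scaler0 scale0r.
Qed.

Lemma complex_fan_of_points (R : realType) (d r n m : nat)
    (x : 'I_n -> 'rV[R[i]]_m) (col : 'I_n -> 'I_(2 * d + 1)) :
    (n = m + 1 + d)%N -> (0 < m)%N -> (1 < r)%N -> prime r.+1 ->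
    (forall a b, (forall i, dotv a (x i) = b) -> a = 0) ->
    (forall k, (r <= #|[pred i | col i == k]|)%N) ->
  exists (B : 'I_r -> set 'rV[R[i]]_m) (C : set 'rV[R[i]]_m),
    [/\ complex_regular_fan B C, forall i, exists j, B j (x i) &
        forall j i i', col i = col i' -> (B j `\` C) (x i) -> (B j `\` C) (x i') ->
          i = i'].
Proof.
move=> nE m0 r1 r1_prime xs col_r.
have [G GP] := gale_dual nE xs.
have dE : (2 * d + 1 = (d + d).+1)%N by lia.
have [cls [T [s [b [T0 s0 rainbow sumT]]]]] :=
  rainbow_tverberg (fun i => realify (G i)) r1_prime r1 dE col_r.
pose om (j : nat) := unity R r j.
pose S j := \sum_(i | cls i == j) (T i)%:C%C *: G i.
have SE j j' : S j = S j'.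
  have realS l : realify (S l) = b.
    rewrite -(sumT l).2 realify_sum; apply: eq_bigr => i _; exact: realifyZ.
  by apply: realify_inj; rewrite !realS.
pose j0 : 'I_r := Ordinal (ltnW r1).
(* All class sums equal [S j0], which gets the factor [\sum_j om j = 0]. *)
have [|a0 [be0 aE]] := GP (fun i => (T i)%:C%C * om (cls i)).
  rewrite (partition_big cls predT) //=.
  rewrite (eq_bigr (fun j : 'I_r => om j *: S j0)) => [|j _].
    by rewrite -scaler_suml (sum_unity R r1) scale0r.
  rewrite -(SE j j0) /S scaler_sumr; apply: eq_bigr => i /eqP <-.
  by rewrite scalerA mulrC.
have positive j : exists2 i, cls i = j & 0 < T i.
  apply: contrapT => none; have := s0; rewrite -(sumT j).1 big1 ?ltxx // => i /eqP ij.
  by apply/eqP; rewrite eq_le T0 andbT leNgt; apply/negP => Ti; apply: none; exists i.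
have realC_neq0 (t : R) : 0 < t -> t%:C%C != 0.
  by move=> t0; rewrite -[0]/(0%:C%C) (inj_eq (@complexI R)) gt_eqF.
(* With [a0 = 0] every root of unity would be a positive multiple of [- be0]; as they sum to [0],
   [be0] would vanish, and the roots with it. *)
have a0_neq0 : a0 != 0.
  apply/eqP => a00; have [w wc wT] := fin_all_exists2 positive.
  have omE (j : 'I_r) : om j = - be0 * ((T (w j))^-1)%:C%C.
    have := aE (w j); rewrite wc a00 /dotv big1 => [|l _]; last by rewrite mxE mul0r.
    rewrite sub0r => <-; rewrite mulrAC -rmorphM /= divff ?gt_eqF //.
    by rewrite mul1r.
  have := sum_unity R r1; rewrite (eq_bigr (fun j : 'I_r => - be0 * ((T (w j))^-1)%:C%C)).
    rewrite -mulr_sumr -rmorph_sum => /eqP; rewrite mulf_eq0.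
    case/orP => [/eqP b0|].
      by have := unity_neq0 R r j0; rewrite -/(om j0) omE b0 mul0r eqxx.
    apply/negP/realC_neq0; rewrite (bigD1 j0) //= ltr_pwDl ?invr_gt0 //.
    by apply: sumr_ge0 => j _; rewrite invr_ge0.
  by move=> j _; exact: omE.
have [nu nu0 nuE] := dotv_conj_gt0 a0_neq0.
(* Scaling by a positive real makes [a] a unit vector and keeps the directions of the rays. *)
pose c := (Num.sqrt nu)^-1; have c0 : 0 < c by rewrite invr_gt0 sqrtr_gt0.
have cc : c * c * nu = 1.
  by rewrite -expr2 exprVn sqr_sqrtr ?ltW // mulVf ?gt_eqF.
pose a := c%:C%C *: a0; pose be := c%:C%C * be0.
have a_unit : dotv a (map_mx conjc a) = 1.
  have -> : map_mx conjc a = c%:C%C *: map_mx conjc a0.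
    apply/rowP => l; rewrite !mxE rmorphM; congr (_ * _).
    by apply/eqP; rewrite eq_complex /= oppr0 !eqxx.
  rewrite /a dotvZl dotvZr nuE mulrA -!rmorphM cc.
  by [].
have xE i : dotv a (x i) = be + (c * T i)%:C%C * om (cls i).
  rewrite /a dotvZl -[dotv a0 (x i)](subrK be0) -aE mulrDr addrC mulrA.
  by rewrite rmorphM.
exists (fun j : 'I_r => ray_set r a be j), (hyperplane a be); split.
- exact: unit_complex_regular_fan.
- by move=> i; exists (cls i), (c * T i); split; rewrite ?xE // mulr_ge0 // ltW.
- have clsE (j : 'I_r) i : (ray_set r a be j `\` hyperplane a be) (x i) -> cls i = j /\ T i != 0.
    move=> [[t [t0 xt]] nC].
    have Ti : T i != 0.
      by apply/eqP => Ti; apply: nC; rewrite /hyperplane /= xE Ti mulr0 mul0r addr0.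
    split=> //; apply: (unity_ray_inj r1 (t := c * T i) _ t0).
      by rewrite mulr_gt0 // lt_def Ti T0.
    by apply: (addrI be); rewrite -xE xt.
  by move=> j i i' ii' /clsE[ci Ti] /clsE[ci' Ti']; apply: rainbow => //; rewrite ci ci'.
Qed.

(** * From enumerated points back to coloured sets *)

Lemma spanning_dotv (F : fieldType) n m (X : {fset 'rV[F]_m}) (x : 'I_n -> 'rV[F]_m) :
    (forall v, v \in X -> exists i, v = x i) -> affinely_spanning [set` X] ->
  forall a b, (forall i, dotv a (x i) = b) -> a = 0.
Proof.
move=> Xx span a b ab; apply/eqP; apply: contraT => a0.
have Hab : is_hyperplane (hyperplane a b) by exists a, b.
by case: (span _ Hab) => v /Xx[i ->]; exact: ab.
Qed.

Lemma rainbow_distributes_of_points (V : choiceType) n r c (B : 'I_r -> set V) (C : set V)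
    (X : {fset V}) (Xs : 'I_c -> {fset V}) (x : 'I_n -> V) (col : 'I_n -> 'I_c) :
    [set` X] = \bigcup_(i in [set: 'I_c]) [set` Xs i] ->
    (forall v, v \in X -> exists i, v = x i) ->
    (forall i k, x i \in Xs k -> col i = k) ->
    (forall i, exists j, B j (x i)) ->
    (forall j i i', col i = col i' -> (B j `\` C) (x i) -> (B j `\` C) (x i') -> i = i') ->
  rainbow_distributes B C Xs X.
Proof.
move=> XE Xx colE cover inj; split.
  by move=> v /Xx[i ->]; have [j Bj] := cover i; exists j.
move=> j k; set A := _ `&` _.
have A1 v w : A v -> A w -> v = w.
  move=> [BCv Xv] [BCw Xw].
  have XsX u : u \in Xs k -> u \in X.
    by move=> uk; suff : [set` X] u by []; rewrite XE; exists k.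
  have [i vE] := Xx v (XsX v Xv); have [i' wE] := Xx w (XsX w Xw); subst v w.
  by congr x; apply: (inj j) => //; rewrite (colE _ _ Xv) (colE _ _ Xw).
have [->|/set0P[v Av]] := eqVneq A set0; first exact: card_ge0.
have /card_eqPle[v1 _] := @card_set1 _ v.
by apply: card_le_trans v1; apply: subset_card_le => w /(A1 _ _ Av) ->.
Qed.

Theorem theorem1p6 (R : realType) (d : nat) (hd : (1 <= d)%N) :
  (forall (r n : nat) (X : {fset 'rV[R]_(n - d - 1)})
          (Xs : 'I_(d + 1) -> {fset 'rV[R]_(n - d - 1)}),
     (4 <= r)%N -> prime (r + 1) -> (r * (d + 1) <= n)%N ->
     #|` X| = n -> affinely_spanning [set` X] ->
     coloring Xs X -> (forall i, (r <= #|` Xs i|)%N) ->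
     exists (B : 'I_r -> set 'rV[R]_(n - d - 1)) (C : set 'rV[R]_(n - d - 1)),
       conical_fan B C /\ rainbow_distributes B C Xs X) /\
  (forall (r n : nat) (X : {fset 'rV[R[i]]_(n - d - 1)})
          (Xs : 'I_(2 * d + 1) -> {fset 'rV[R[i]]_(n - d - 1)}),
     (2 <= r)%N -> prime (r + 1) -> (r * (2 * d + 1) <= n)%N ->
     #|` X| = n -> affinely_spanning [set` X] ->
     coloring Xs X -> (forall i, (r <= #|` Xs i|)%N) ->
     exists (B : 'I_r -> set 'rV[R[i]]_(n - d - 1))
            (C : set 'rV[R[i]]_(n - d - 1)),
       complex_regular_fan B C /\ rainbow_distributes B C Xs X).
Proof.
split=> r n X Xs r_ge; rewrite addn1 => r1_prime n_ge Xn Xspan Xcol Xs_ge.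
  have [x [col [Xx xX colE col_ge]]] := enumerate_coloring Xn Xcol Xs_ge.
  (* The bound on [n] gives [d + 1 <= n], so the subtractions are not truncated. *)
  have nE : (n = (n - d - 1) + 1 + d)%N by nia.
  have [B [C [fan cover inj]]] :=
    conical_fan_of_points nE (ltnW r_ge) r1_prime (spanning_dotv Xx Xspan) col_ge.
  exists B, C; split => //; case: Xcol => Xcov _ _.
  exact: rainbow_distributes_of_points (esym Xcov) Xx colE cover inj.
have [x [col [Xx xX colE col_ge]]] := enumerate_coloring Xn Xcol Xs_ge.
have nE : (n = (n - d - 1) + 1 + d)%N by nia.
have m0 : (0 < n - d - 1)%N by nia.
have [B [C [fan cover inj]]] :=
  complex_fan_of_points nE m0 r_ge r1_prime (spanning_dotv Xx Xspan) col_ge.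
exists B, C; split => //; case: Xcol => Xcov _ _.
exact: rainbow_distributes_of_points (esym Xcov) Xx colE cover inj.
Qed.
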